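(* Let $N\in\mathbb N$, $\alpha,\beta>-1$, and let $\{x_j,\omega_j\}_{j=0}^N$ be the JGL nodes and weights. Then for $\mu\in(0,1)$ and $0\le i,j\le N$, $$ \hat{\mathbf I}^{(\mu)}_{ij}=\sum_{l=0}^N\frac{l!}{\Gamma(l+\mu+1)}\,\hat s_{lj}\,P_l^{(-\mu,\mu)}(x_i),\qquad \hat s_{lj}=\sum_{n=l}^N {}^{(\alpha,\beta)}C^{(0,0)}_{ln}\,t_{nj},\qquad t_{nj}=\frac{\omega_j}{\tilde\gamma_n^{(\alpha,\beta)}}P_n^{(\alpha,\beta)}(x_j). $$ In particular, if $\alpha=\beta=0$ then $\hat s_{lj}=t_{lj}$.
   Context: For $\rho>0$, $(I_-^\rho u)(x)=\frac{1}{\Gamma(\rho)}\int_{-1}^x (x-y)^{\rho-1}u(y)\,dy$, and $\hat I_-^\mu u=(1+x)^{-\mu}I_-^\mu u$ (for polynomial $u$ this is a polynomial; its value at $-1$ is taken). Jacobi polynomials are in Szegő's normalization: $P_n^{(\alpha,\beta)}(x)=\frac{\Gamma(n+\alpha+1)}{n!\Gamma(\alpha+1)}\,{}_2F_1\big(-n,n+\alpha+\beta+1;\alpha+1;\tfrac{1-x}{2}\big)$, $P_0^{(\alpha,\beta)}=1$. For $\alpha,\beta>-1$, $\gamma_n^{(\alpha,\beta)}=\frac{2^{\alpha+\beta+1}\Gamma(n+\alpha+1)\Gamma(n+\beta+1)}{(2n+\alpha+\beta+1)\,n!\,\Gamma(n+\alpha+\beta+1)}$; $\tilde\gamma_n^{(\alpha,\beta)}=\gamma_n^{(\alpha,\beta)}$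 for $0\le n\le N-1$ and $\tilde\gamma_N^{(\alpha,\beta)}=\big(2+\frac{\alpha+\beta+1}{N}\big)\gamma_N^{(\alpha,\beta)}$. Connection coefficients: for $\alpha,\beta,a,b>-1$, ${}^{(\alpha,\beta)}C^{(a,b)}_{ln}$ are the unique numbers with $P_n^{(\alpha,\beta)}=\sum_{l=0}^n {}^{(\alpha,\beta)}C^{(a,b)}_{ln}P_l^{(a,b)}$. The JGL nodes $x_0<\dots<x_N$ are the zeros of $(1-x^2)\frac{d}{dx}P_N^{(\alpha,\beta)}$ and the weights $\omega_j$ make $\int_{-1}^1\phi(1-x)^\alpha(1+x)^\beta dx=\sum_j\phi(x_j)\omega_j$ exact for $\phi\in\mathcal P_{2N-1}$. $h_j\in\mathcal P_N$ with $h_j(x_i)=\delta_{ij}$, and $\hat{\mathbf I}^{(\mu)}_{ij}=(\hat I_-^\mu h_j)(x_i)$. *)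

(* Defs.v *)
From Stdlib Require Import Arith Factorial Reals Lra ClassicalEpsilon.
Open Scope R_scope.

Fixpoint prodR (n : nat) (f : nat -> R) : R :=
  match n with O => 1 | S m => prodR m f * f m end.

Definition poch (a : R) (k : nat) : R := prodR k (fun i => a + INR i).

Definition improper_int (f : R -> R) (a b L : R) : Prop :=
  forall eps, 0 < eps -> exists del, 0 < del /\
    forall u v, a < u < a + del -> b - del < v < b ->
      exists pr : Riemann_integrable f u v, Rabs (RiemannInt pr - L) < eps.

Definition improper_int_0inf (f : R -> R) (L : R) : Prop :=
  forall eps, 0 < eps -> exists del, 0 < del /\ exists M,
    forall u v, 0 < u < del -> M < v ->
      exists pr : Riemann_integrable f u v, Rabs (RiemannInt pr - L) < eps.

(* Euler's Gamma function (only used for positive arguments) *)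
Definition Gamma (s : R) : R :=
  epsilon (inhabits 0)
    (fun L => improper_int_0inf (fun t => Rpower t (s - 1) * exp (- t)) L).

(* Jacobi polynomial, Szego normalization, via the terminating 2F1 *)
Definition Jacobi (a b : R) (n : nat) (x : R) : R :=
  Gamma (INR n + a + 1) / (INR (fact n) * Gamma (a + 1)) *
  sum_f_R0 (fun k => poch (- INR n) k * poch (INR n + a + b + 1) k
                      / (poch (a + 1) k * INR (fact k)) * ((1 - x) / 2) ^ k) n.

(* gamma_n^{(a,b)}; for n = 0 the factor (a+b+1) Gamma(a+b+1) is written
   as Gamma(a+b+2) (standard convention, also covers a+b+1 <= 0). *)
Definition gamma_n (a b : R) (n : nat) : R :=
  match n with
  | O => Rpower 2 (a + b + 1) * Gamma (a + 1) * Gamma (b + 1) / Gamma (a + b + 2)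
  | _ => Rpower 2 (a + b + 1) * Gamma (INR n + a + 1) * Gamma (INR n + b + 1)
         / ((2 * INR n + a + b + 1) * INR (fact n) * Gamma (INR n + a + b + 1))
  end.

Definition gamma_tilde (a b : R) (N n : nat) : R :=
  if Nat.eqb n N then (2 + (a + b + 1) / INR N) * gamma_n a b n else gamma_n a b n.

Definition conn (a b c d : R) (l n : nat) : R :=
  epsilon (inhabits (fun _ : nat => 0))
    (fun C : nat -> R => forall y, Jacobi a b n y = sum_f_R0 (fun k => C k * Jacobi c d k y) n) l.

Definition is_JGL (a b : R) (N : nat) (x w : nat -> R) : Prop :=
  (forall j, (j < N)%nat -> x j < x (S j)) /\
  (forall y, (exists j, (j <= N)%nat /\ x j = y) <->
             exists d, derivable_pt_lim (Jacobi a b N) y d /\ (1 - y ^ 2) * d = 0) /\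
  (forall c : nat -> R,
     improper_int
       (fun y => sum_f_R0 (fun k => c k * y ^ k) (2 * N - 1) * Rpower (1 - y) a * Rpower (1 + y) b)
       (-1) 1
       (sum_f_R0 (fun j => sum_f_R0 (fun k => c k * x j ^ k) (2 * N - 1) * w j) N)).

Definition lagrange (x : nat -> R) (N j : nat) (y : R) : R :=
  prodR (S N) (fun k => if Nat.eqb k j then 1 else (y - x k) / (x j - x k)).

Definition Ifrac (rho : R) (u : R -> R) (x : R) : R :=
  / Gamma rho * epsilon (inhabits 0)
    (fun L => improper_int (fun y => Rpower (x - y) (rho - 1) * u y) (-1) x L).

Definition Ihat (mu : R) (u : R -> R) (x : R) : R :=
  Rpower (1 + x) (- mu) * Ifrac mu u x.

(* matrix entry (hat I_-^mu h_j)(x_i), as the value of the polynomial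
   (hat I^mu h_j) at x_i, i.e. its limit from within (-1, oo)
   (this also gives the value at x_0 = -1) *)
Definition Ihat_mat (mu : R) (x : nat -> R) (N i j : nat) : R :=
  epsilon (inhabits 0)
    (fun L => limit1_in (Ihat mu (lagrange x N j)) (fun y => -1 < y) L (x i)).

Definition t_coef (a b : R) (N : nat) (x w : nat -> R) (n j : nat) : R :=
  w j / gamma_tilde a b N n * Jacobi a b n (x j).

Definition s_hat (a b : R) (N : nat) (x w : nat -> R) (l j : nat) : R :=
  sum_f l N (fun n => conn a b 0 0 l n * t_coef a b N x w n j).

(* Main.v *)
Require Import Defs.
From Stdlib Require Import Arith Factorial Reals Lra Lia ClassicalEpsilon.
From Coquelicot Require Import Coquelicot.
From HB Require Import structures.
From mathcomp Require all_boot all_order all_algebra ring lra Rstruct.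
Open Scope R_scope.

(* In the variable z = (1 - x)/2 the Jacobi weight has the moments
   M (a+1)_k / (a+b+2)_k, where M is a Beta integral; the Beta integral is
   evaluated by the log-convexity argument of Bohr and Mollerup.  The ratio of
   consecutive moments gives integration by parts for the moment functional,
   hence the orthogonality of the Jacobi polynomials, and their norms follow by
   induction from P_n' ~ P_{n-1}^{(a+1,b+1)}.  The quadrature is exact up to
   degree 2N - 1; the one product of degree 2N, P_N^2, is reached through
   N^2 P_N^2 + z (1 - z) P_N'^2, which has lower degree and whose second term
   vanishes at the nodes.  So the P_n are orthogonal for the discrete inner
   product with squared norms gamma_tilde, and h_j = sum_n t_nj P_n.  Rewriting
   this in Legendre polynomials gives the coefficients s_hat.  Finally P_l(x) =
   (-1)^l P_l(-x) is expanded in powers of 1 + x, which are integrated termwise,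
   and the result is (-1)^l P_l^{(mu,-mu)}(-x) = P_l^{(-mu,mu)}(x) up to the
   factor l!/Gamma(l+mu+1). *)

(** * Improper integrals *)

(** The statement fixes [Gamma], the connection coefficients, the fractional integral and the matrix
    entries by [epsilon], so every use of their values rests on an existence proof, and comparing
    two of them on uniqueness as well. Gamma values enter the orthogonality theory only through the
    total mass of the weight: once the moments are normalised to mean 1, orthogonality, norms and
    quadrature are algebra over any ordered field, and analysis has to supply only the mass and the
    moments. The node -1 lies outside the range where the integral formula makes sense, so the
    identity is proved for [y > -1] and carried to the nodes by continuity. This requires every node
    to be at least -1. The nodes are given as zeros on the whole line, so that bound has to be
    derived; it comes from the signs of the terms of the hypergeometric series. *)

(* [D] is an open interval, [Fa] and [Fb] are the filters of its two ends. *)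
Record interval_ends (D : R -> Prop) (Fa Fb : (R -> Prop) -> Prop) : Prop := {
  ends_convex : forall u v t, D u -> D v -> u <= t <= v -> D t;
  ends_left : forall c, D c -> Fa (fun u => D u /\ u < c);
  ends_right : forall c, D c -> Fb (fun v => D v /\ c < v);
  ends_inhabited : exists c, D c
}.

Section ImproperIntegral.

Variables (D : R -> Prop) (Fa Fb : (R -> Prop) -> Prop).
Context {FFa : ProperFilter Fa} {FFb : ProperFilter Fb}.
Hypothesis D_ends : interval_ends D Fa Fb.

Let D_convex := ends_convex _ _ _ D_ends.
Let D_left := ends_left _ _ _ D_ends.
Let D_right := ends_right _ _ _ D_ends.
Let D_inhabited := ends_inhabited _ _ _ D_ends.

(** The left bound is kept below [d] as well as below [c]. This puts the two bounds in order, and no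
    case on the orientation of the integral remains. *)
Lemma filter_prod_ends (c d : R) (P : R -> R -> Prop) :
  D c -> D d ->
  (forall u v, D u -> D v -> u < c -> d < v -> u < v -> P u v) ->
  filter_prod Fa Fb (fun uv => P (fst uv) (snd uv)).
Proof.
intros Dc Dd H.
apply (Filter_prod Fa Fb _ (fun u => (D u /\ u < c) /\ (D u /\ u < d))
                           (fun v => D v /\ d < v)).
- apply filter_and; auto.
- now apply D_right.
- intros u v [[? ?] [? ?]] [? ?]; apply H; auto; simpl; lra.
Qed.

Lemma filter_prod_interval (P : R -> Prop) :
  (forall t, D t -> P t) ->
  filter_prod Fa Fb (fun uv => forall t,
    Rmin (fst uv) (snd uv) <= t <= Rmax (fst uv) (snd uv) -> P t).
Proof.
intros H; destruct D_inhabited as [c Dc].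
apply (filter_prod_ends c c (fun u v => forall t, Rmin u v <= t <= Rmax u v -> P t)); auto.
intros u v Du Dv _ _ uv t; rewrite Rmin_left, Rmax_right by lra.
intros ut; apply H; eauto.
Qed.

Lemma improper_ext (f g : R -> R) (l : R) :
  (forall t, D t -> f t = g t) ->
  is_RInt_gen f Fa Fb l -> is_RInt_gen g Fa Fb l.
Proof.
intros H; apply is_RInt_gen_ext.
eapply filter_imp; [|exact (filter_prod_interval (fun t => f t = g t) H)].
intros uv K t ut; apply K; lra.
Qed.

Lemma improper_scal (f : R -> R) (k l : R) :
  is_RInt_gen f Fa Fb l -> is_RInt_gen (fun t => k * f t) Fa Fb (k * l).
Proof. exact (is_RInt_gen_scal f k l). Qed.

Lemma improper_plus (f g : R -> R) (l m : R) :
  is_RInt_gen f Fa Fb l -> is_RInt_gen g Fa Fb m ->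
  is_RInt_gen (fun t => f t + g t) Fa Fb (l + m).
Proof. exact (is_RInt_gen_plus f g l m). Qed.

Lemma improper_unique (f : R -> R) (l m : R) :
  is_RInt_gen f Fa Fb l -> is_RInt_gen f Fa Fb m -> l = m.
Proof.
intros H1 H2.
now rewrite <- (is_RInt_gen_unique _ _ H1), (is_RInt_gen_unique _ _ H2).
Qed.

Lemma improper_sum (n : nat) (f : nat -> R -> R) (l : nat -> R) :
  (forall k, (k <= n)%nat -> is_RInt_gen (f k) Fa Fb (l k)) ->
  is_RInt_gen (fun t => sum_f_R0 (fun k => f k t) n) Fa Fb (sum_f_R0 l n).
Proof.
induction n as [|n IH]; intros H; simpl.
- apply (H 0%nat); lia.
- apply improper_plus; auto.
Qed.

Lemma improper_le (f g : R -> R) (l m : R) :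
  (forall t, D t -> 0 <= f t <= g t) ->
  is_RInt_gen f Fa Fb l -> is_RInt_gen g Fa Fb m -> l <= m.
Proof.
intros H Hf Hg; destruct D_inhabited as [c Dc].
apply Rle_trans with (1 := Rle_abs l).
refine (RInt_gen_norm f g l m _ _ Hf Hg).
- apply (filter_prod_ends c c (fun u v => u <= v)); auto; intros; lra.
- apply (filter_prod_ends c c (fun u v => forall t, u <= t <= v -> norm (f t) <= g t)); auto.
  intros u v Du Dv _ _ _ t ut.
  assert (Dt : D t) by eauto.
  destruct (H t Dt); unfold norm; simpl; unfold abs; simpl.
  now rewrite Rabs_pos_eq.
Qed.

Lemma improper_derive (F f : R -> R) (la lb : R) :
  (forall t, D t -> is_derive F t (f t)) ->
  (forall t, D t -> continuous f t) ->
  filterlim F Fa (locally la) -> filterlim F Fb (locally lb) ->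
  is_RInt_gen f Fa Fb (lb - la).
Proof.
intros HF Hf Ha Hb.
apply improper_ext with (Derive F).
{ now intros t Dt; apply is_derive_unique, HF. }
apply is_RInt_gen_Derive; auto.
- apply (filter_prod_interval (fun t => ex_derive F t)).
  intros t Dt; eexists; now apply HF.
- destruct D_inhabited as [c Dc].
  apply (filter_prod_ends c c
    (fun u v => forall t, Rmin u v <= t <= Rmax u v -> continuous (Derive F) t)); auto.
  intros u v Du Dv uc cv uv t; rewrite Rmin_left, Rmax_right by lra; intros ut.
  assert (Dt : D t) by eauto.
  (* Continuity of [Derive F] at [t] needs [Derive F = f] on a neighbourhood, even when [t] is [u]
     or [v]; the points [u'] and [v'] of [D] leave room on both sides. *)
  destruct (filter_ex _ (D_left u Du)) as [u' [Du' ?]].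
  destruct (filter_ex _ (D_right v Dv)) as [v' [Dv' ?]].
  apply continuous_ext_loc with f; [|now apply Hf].
  assert (e : 0 < Rmin (t - u') (v' - t)) by (apply Rmin_pos; lra).
  exists (mkposreal _ e); intros y Hy.
  change (Rabs (y - t) < Rmin (t - u') (v' - t)) in Hy.
  apply Rabs_def2 in Hy.
  pose proof (Rmin_l (t - u') (v' - t)); pose proof (Rmin_r (t - u') (v' - t)).
  symmetry; apply is_derive_unique, HF; apply (D_convex u' v'); auto; lra.
Qed.

(* The integrals over compact subintervals increase and are bounded by the
   oscillation of [G]; their supremum is the improper integral. *)
Lemma improper_exists (f G g : R -> R) (M : R) :
  (forall t, D t -> continuous f t) ->
  (forall t, D t -> 0 <= f t <= g t) ->
  (forall t, D t -> continuous g t) ->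
  (forall t, D t -> is_derive G t (g t)) ->
  (forall t, D t -> Rabs (G t) <= M) ->
  exists l, is_RInt_gen f Fa Fb l.
Proof.
intros Cf Hf Cg HG BG; destruct D_inhabited as [c Dc].
assert (Ef : forall h, (forall t, D t -> continuous h t) ->
  forall u v, D u -> D v -> u <= v -> ex_RInt (h : R -> R) u v).
{ intros h Ch u v Du Dv uv; apply (@ex_RInt_continuous R_CompleteNormedModule).
  intros t; rewrite Rmin_left, Rmax_right by lra; intros; apply Ch; eauto. }
set (E := fun r => exists u v, D u /\ D v /\ u <= v /\ r = RInt f u v).
destruct (completeness E) as [l [Hub Hlub]].
- exists (2 * M); intros r (u & v & Du & Dv & uv & ->).
  apply Rle_trans with (RInt g u v).
  { apply RInt_le; auto; intros; apply Hf; apply (D_convex u v); auto; lra. }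
  assert (HI : is_RInt g u v (minus (G v) (G u))).
  { apply (@is_RInt_derive R_CompleteNormedModule);
    intros t; rewrite Rmin_left, Rmax_right by lra; intros ut;
    [apply HG | apply Cg]; eauto. }
  rewrite (is_RInt_unique _ _ _ _ HI).
  generalize (BG u Du) (BG v Dv); unfold minus, plus, opp; simpl.
  intros Hu Hv; apply Rabs_le_between in Hu; apply Rabs_le_between in Hv; lra.
- exists (RInt f c c); exists c, c; repeat split; auto; lra.
- exists l; apply filterlimi_locally; intros eps.
  destruct (Classical_Prop.classic (exists r, E r /\ l - eps < r)) as [(r & Er & lr)|No].
  + destruct Er as (u0 & v0 & Du0 & Dv0 & uv0 & ->).
    apply (filter_prod_ends u0 v0 (fun u v => exists z, is_RInt f u v z /\ ball l eps z)); auto.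
    intros u v Du Dv uu vv uv; exists (RInt f u v).
    assert (Ifuv : ex_RInt f u v) by (apply Ef; auto; lra).
    split; [now apply (@RInt_correct R_CompleteNormedModule)|].
    assert (RInt f u v <= l) by (apply Hub; exists u, v; repeat split; auto; lra).
    assert (I1 : ex_RInt f u u0) by (apply Ef; auto; lra).
    assert (I2 : ex_RInt f u0 v0) by (apply Ef; auto; lra).
    assert (I3 : ex_RInt f v0 v) by (apply Ef; auto; lra).
    assert (I4 : ex_RInt f u0 v) by (apply Ef; auto; lra).
    pose proof (RInt_Chasles f u u0 v I1 I4) as E1.
    pose proof (RInt_Chasles f u0 v0 v I2 I3) as E2.
    unfold plus in E1, E2; simpl in E1, E2.
    assert (0 <= RInt f u u0).
    { apply RInt_ge_0; auto; [lra|]; intros; apply Hf, (D_convex u u0); auto; lra. }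
    assert (0 <= RInt f v0 v).
    { apply RInt_ge_0; auto; [lra|]; intros; apply Hf, (D_convex v0 v); auto; lra. }
    change (Rabs (RInt f u v - l) < eps).
    apply Rabs_def1; lra.
  + exfalso.
    assert (l <= l - eps).
    { apply Hlub; intros r Er; apply Rnot_lt_le; intros lr; apply No; eauto. }
    destruct eps as [e He]; simpl in *; lra.
Qed.

Lemma improper_pos (f : R -> R) (l : R) :
  (forall t, D t -> continuous f t) -> (forall t, D t -> 0 < f t) ->
  is_RInt_gen f Fa Fb l -> 0 < l.
Proof.
intros Cf Pf Hl; destruct D_inhabited as [c Dc].
destruct (filter_ex _ (D_left c Dc)) as [a [Da ac]].
assert (P : 0 < RInt f a c).
{ apply RInt_gt_0; auto; intros; [apply Pf|apply Cf]; apply (D_convex a c); auto; lra. }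
apply Rnot_le_lt; intros l0.
(* The radius is the integral over [[a, c]]. An integral over a larger interval is at least as big,
   so it cannot be that close to a nonpositive limit. *)
pose proof (proj1 (filterlimi_locally _ l) Hl (mkposreal _ P)) as Hl'.
assert (K : filter_prod Fa Fb (fun uv => D (fst uv) /\ D (snd uv) /\ fst uv < a /\ c < snd uv)).
{ apply (filter_prod_ends a c (fun u v => D u /\ D v /\ u < a /\ c < v)); auto. }
destruct (filter_ex _ (filter_and _ _ Hl' K)) as [[u v] [[z [Hz Bz]] (Du & Dv & ua & cv)]].
simpl in *.
assert (Ef : forall u v, D u -> D v -> u <= v -> ex_RInt f u v).
{ intros u' v' Du' Dv' uv; apply (@ex_RInt_continuous R_CompleteNormedModule).
  intros t; rewrite Rmin_left, Rmax_right by lra; intros; apply Cf; eauto. }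
assert (I1 : ex_RInt f u a) by (apply Ef; auto; lra).
assert (I2 : ex_RInt f a c) by (apply Ef; auto; lra).
assert (I3 : ex_RInt f c v) by (apply Ef; auto; lra).
assert (I4 : ex_RInt f a v) by (apply Ef; auto; lra).
pose proof (RInt_Chasles f u a v I1 I4) as E1.
pose proof (RInt_Chasles f a c v I2 I3) as E2.
unfold plus in E1, E2; simpl in E1, E2.
rewrite (is_RInt_unique _ _ _ _ Hz) in E1.
assert (0 <= RInt f u a).
{ apply RInt_ge_0; auto; [lra|]; intros; apply Rlt_le, Pf, (D_convex u a); auto; lra. }
assert (0 <= RInt f c v).
{ apply RInt_ge_0; auto; [lra|]; intros; apply Rlt_le, Pf, (D_convex c v); auto; lra. }
change (Rabs (z - l) < RInt f a c) in Bz.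
apply Rabs_def2 in Bz; lra.
Qed.

End ImproperIntegral.

(** * The improper integrals of the statement as limits along filters *)

Lemma at_right_in (a c : R) : a < c -> at_right a (fun u => a < u < c).
Proof.
intros ac; assert (e : 0 < c - a) by lra.
exists (mkposreal _ e); intros y Hy ay; change (Rabs (y - a) < c - a) in Hy.
apply Rabs_def2 in Hy; lra.
Qed.

Lemma at_left_in (b c : R) : c < b -> at_left b (fun v => c < v < b).
Proof.
intros cb; assert (e : 0 < b - c) by lra.
exists (mkposreal _ e); intros y Hy yb; change (Rabs (y - b) < b - c) in Hy.
apply Rabs_def2 in Hy; lra.
Qed.

Lemma improper_intP (f : R -> R) (a b L : R) :
  improper_int f a b L <-> is_RInt_gen f (at_right a) (at_left b) L.
Proof.
unfold is_RInt_gen; rewrite filterlimi_locally; split.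
- intros H eps; destruct (H eps (cond_pos eps)) as [d [d0 K]].
  refine (Filter_prod _ _ _ _ _ (at_right_in a (a + d) _) (at_left_in b (b - d) _) _);
    try lra.
  intros u v Hu Hv; destruct (K u v Hu Hv) as [pr Hpr].
  exists (RiemannInt pr); split; [|exact Hpr].
  rewrite <- RInt_Reals.
  now apply (@RInt_correct R_CompleteNormedModule), ex_RInt_Reals_1.
- intros H eps e0; destruct (H (mkposreal eps e0)) as [P Q [dP HP] [dQ HQ] K].
  exists (Rmin dP dQ); split; [apply Rmin_pos; apply cond_pos|].
  intros u v Hu Hv.
  pose proof (Rmin_l dP dQ); pose proof (Rmin_r dP dQ).
  destruct (K u v) as [z [Hz Bz]]; simpl in *.
  { apply HP; [|lra]. change (Rabs (u - a) < dP); apply Rabs_def1; lra. }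
  { apply HQ; [|lra]. change (Rabs (v - b) < dQ); apply Rabs_def1; lra. }
  assert (pr : Riemann_integrable f u v) by (apply ex_RInt_Reals_0; now exists z).
  exists pr; rewrite <- RInt_Reals, (is_RInt_unique _ _ _ _ Hz); exact Bz.
Qed.

Lemma improper_int_0infP (f : R -> R) (L : R) :
  improper_int_0inf f L <-> is_RInt_gen f (at_right 0) (Rbar_locally p_infty) L.
Proof.
unfold is_RInt_gen; rewrite filterlimi_locally; split.
- intros H eps; destruct (H eps (cond_pos eps)) as [d [d0 [M K]]].
  refine (Filter_prod _ _ _ _ (fun v => M < v) (at_right_in 0 d _) _ _);
    [lra|now exists M|].
  intros u v Hu Hv; destruct (K u v Hu Hv) as [pr Hpr].
  exists (RiemannInt pr); split; [|exact Hpr].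
  rewrite <- RInt_Reals.
  now apply (@RInt_correct R_CompleteNormedModule), ex_RInt_Reals_1.
- intros H eps e0; destruct (H (mkposreal eps e0)) as [P Q [dP HP] [M HQ] K].
  exists dP; split; [apply cond_pos|]; exists M.
  intros u v Hu Hv.
  destruct (K u v) as [z [Hz Bz]]; simpl in *.
  { apply HP; [|lra]. change (Rabs (u - 0) < dP); apply Rabs_def1; lra. }
  { now apply HQ. }
  assert (pr : Riemann_integrable f u v) by (apply ex_RInt_Reals_0; now exists z).
  exists pr; rewrite <- RInt_Reals, (is_RInt_unique _ _ _ _ Hz); exact Bz.
Qed.

Lemma bounded_interval_ends (a b : R) :
  a < b -> interval_ends (fun t => a < t < b) (at_right a) (at_left b).
Proof.
intros ab; split.
- intros; lra.
- intros c [ac cb]; eapply filter_imp; [|exact (at_right_in a c ac)]; simpl; intros; lra.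
- intros c [ac cb]; eapply filter_imp; [|exact (at_left_in b c cb)]; simpl; intros; lra.
- exists ((a + b) / 2); lra.
Qed.

Lemma positive_ends :
  interval_ends (fun t => 0 < t) (at_right 0) (Rbar_locally p_infty).
Proof.
split.
- intros; lra.
- intros c c0; eapply filter_imp; [|exact (at_right_in 0 c c0)]; simpl; intros; lra.
- intros c c0; exists c; intros; lra.
- exists 1; lra.
Qed.

(** * Real powers *)

Lemma Rpower_pos (x y : R) : 0 < Rpower x y.
Proof. apply exp_pos. Qed.

Lemma is_derive_Rpower (t s : R) :
  0 < t -> is_derive (fun u => Rpower u s) t (s * Rpower t (s - 1)).
Proof. intros t0; apply is_derive_Reals; now apply derivable_pt_lim_power. Qed.

Lemma Rpower_succ (t s : R) : 0 < t -> Rpower t (s + 1) = Rpower t s * t.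
Proof. intros t0; now rewrite Rpower_plus, Rpower_1. Qed.

Lemma Rpower_pred (t s : R) : 0 < t -> Rpower t s = Rpower t (s - 1) * t.
Proof. intros t0; rewrite <- Rpower_succ by auto; f_equal; lra. Qed.

Lemma Rpower_one (s : R) : Rpower 1 s = 1.
Proof. unfold Rpower; rewrite ln_1, Rmult_0_r; apply exp_0. Qed.

Lemma Rpower_lt_1 (y s : R) : 0 < s -> 0 < y < 1 -> 0 < Rpower y s < 1.
Proof.
intros s0 y01; split; [apply Rpower_pos|].
rewrite <- (Rpower_one s); apply Rlt_Rpower_l; lra.
Qed.

Lemma filterlim_Rpower_0 (s : R) :
  0 < s -> filterlim (fun t => Rpower t s) (at_right 0) (locally 0).
Proof.
intros s0; apply filterlim_locally; intros [e e0].
eapply filter_imp; [|exact (at_right_in 0 (Rpower e (/ s)) (Rpower_pos _ _))].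
intros t [t0 te]; change (Rabs (Rpower t s - 0) < e).
rewrite Rminus_0_r, Rabs_pos_eq by (apply Rlt_le, Rpower_pos).
replace e with (Rpower (Rpower e (/ s)) s).
- apply Rlt_Rpower_l; auto.
- rewrite Rpower_mult, Rinv_l, Rpower_1; lra.
Qed.

Lemma filterlim_0_squeeze (F : (R -> Prop) -> Prop) (FF : Filter F) (f g : R -> R) (C : R) :
  F (fun t => 0 <= f t <= C * g t) ->
  filterlim g F (locally 0) -> filterlim f F (locally 0).
Proof.
intros H Hg.
apply (filterlim_le_le (fun _ => 0) f (fun t => C * g t) 0); auto.
- apply filterlim_const.
- change (filterlim (fun t => C * g t) F (locally 0)).
  replace 0 with (C * 0) by ring.
  exact (filterlim_comp _ _ _ g (fun u => C * u) _ _ _ Hg (filterlim_scal_r C 0)).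
Qed.

Lemma ln_le_sub_1 (x : R) : 0 < x -> ln x <= x - 1.
Proof. intros x0; pose proof (exp_ineq1_le (ln x)); rewrite exp_ln in H; lra. Qed.

(** The right side is the tangent at [l] of the concave function [t^s]. With [r = t / l], the bound
    [exp v >= 1 + v] is used at [(1 - s) ln r] and at [- s ln r]; with weights [s] and [1 - s] the
    logarithms cancel. *)
Lemma Rpower_tangent (t l s : R) :
  0 < t -> 0 < l -> 0 <= s <= 1 ->
  Rpower t s <= Rpower l s * ((1 - s) + s / l * t).
Proof.
intros t0 l0 s01.
assert (r0 : 0 < t / l) by (apply Rdiv_lt_0_compat; lra).
replace t with (l * (t / l)) at 1 by (field; lra).
rewrite <- Rpower_mult_distr by auto.
apply Rmult_le_compat_l; [apply Rlt_le, Rpower_pos|].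
replace (s / l * t) with (s * (t / l)) by (field; lra).
set (r := t / l) in *; unfold Rpower; set (x := ln r).
assert (E1 : r = exp (s * x) * exp ((1 - s) * x)).
{ rewrite <- exp_plus; replace (_ + _) with x by ring; unfold x; now rewrite exp_ln. }
assert (E2 : 1 = exp (s * x) * exp (- (s * x))).
{ rewrite <- exp_plus; replace (_ + _) with 0 by ring; now rewrite exp_0. }
pose proof (exp_ineq1_le ((1 - s) * x)); pose proof (exp_ineq1_le (- (s * x))).
pose proof (exp_pos (s * x)); set (E := exp (s * x)) in *.
assert (E * (1 + (1 - s) * x) <= r) by (rewrite E1; nra).
assert (E * (1 + - (s * x)) <= 1) by (rewrite E2; nra).
nra.
Qed.

(** * The Gamma function *)

(** [t^s exp(-t/2)] peaks at [t = 2 s] with value [(2 s)^s exp(-s)], of which the factor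
    [exp(-s) <= 1] is dropped. *)
Lemma Rpower_exp_bound (s t : R) :
  0 < s -> 0 < t ->
  Rpower t s * exp (- t) <= Rpower (2 * s) s * exp (- t / 2).
Proof.
intros s0 t0; unfold Rpower; rewrite <- !exp_plus.
assert (r0 : 0 < t / (2 * s)) by (apply Rdiv_lt_0_compat; lra).
assert (K : s * ln t + - t <= s * ln (2 * s) + - t / 2).
{ pose proof (ln_le_sub_1 _ r0).
  rewrite ln_div in H by lra.
  assert (s * (ln t - ln (2 * s)) <= s * (t / (2 * s) - 1)) by (apply Rmult_le_compat_l; lra).
  replace (s * (t / (2 * s) - 1)) with (t / 2 - s) in H0 by (field; lra); lra. }
destruct K as [K| ->]; [apply Rlt_le; now apply exp_increasing|lra].
Qed.

Lemma filterlim_exp_half : filterlim (fun t => exp (- t / 2)) (Rbar_locally p_infty) (locally 0).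
Proof.
apply (filterlim_comp _ _ _ (fun t => - t / 2) exp _ (Rbar_locally m_infty)).
- intros P [M HM]; exists (- 2 * M); intros x Hx; apply HM; lra.
- exact is_lim_exp_m.
Qed.

Lemma filterlim_Rpower_exp_0 (s : R) :
  0 < s -> filterlim (fun t => Rpower t s * exp (- t)) (at_right 0) (locally 0).
Proof.
intros s0; apply (filterlim_0_squeeze _ _ _ (fun t => Rpower t s) 1).
- eapply filter_imp; [|exact (at_right_in 0 1 Rlt_0_1)].
  intros t [t0 _]; pose proof (Rpower_pos t s); pose proof (exp_pos (- t)).
  assert (exp (- t) <= 1).
  { rewrite <- exp_0; apply Rlt_le, exp_increasing; lra. }
  split; nra.
- now apply filterlim_Rpower_0.
Qed.

Lemma filterlim_Rpower_exp_infty (s : R) :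
  0 < s -> filterlim (fun t => Rpower t s * exp (- t)) (Rbar_locally p_infty) (locally 0).
Proof.
intros s0.
apply (filterlim_0_squeeze _ _ _ (fun t => exp (- t / 2)) (Rpower (2 * s) s)).
- exists 0; intros t t0; split; [|now apply Rpower_exp_bound].
  apply Rlt_le, Rmult_lt_0_compat; [apply Rpower_pos|apply exp_pos].
- exact filterlim_exp_half.
Qed.

Lemma is_derive_Gamma_primitive (s t : R) :
  0 < t ->
  is_derive (fun u => Rpower u s * exp (- u)) t
    (s * (Rpower t (s - 1) * exp (- t)) - Rpower t s * exp (- t)).
Proof.
intros t0.
assert (D : is_derive (fun u => exp (- u)) t (- exp (- t))) by (auto_derive; [trivial|ring]).
generalize (is_derive_mult _ _ _ _ _ (is_derive_Rpower t s t0) D Rmult_comm).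
unfold plus, mult; simpl; intros H.
replace (_ - _) with (s * Rpower t (s - 1) * exp (- t) + Rpower t s * - exp (- t)) by ring.
exact H.
Qed.

Lemma continuous_Gamma_integrand (s t : R) :
  0 < t -> continuous (fun u => Rpower u (s - 1) * exp (- u)) t.
Proof.
intros t0; apply (@ex_derive_continuous R_AbsRing R_NormedModule).
eexists; now apply is_derive_Gamma_primitive.
Qed.

Lemma Gamma_integral_exists (s : R) :
  0 < s -> exists l,
  is_RInt_gen (fun t => Rpower t (s - 1) * exp (- t)) (at_right 0) (Rbar_locally p_infty) l.
Proof.
intros s0; set (C := Rpower (2 * s) s).
assert (C0 : 0 < C) by apply Rpower_pos.
assert (cont : forall g : R -> R, forall t, ex_derive g t -> continuous g t).
{ intros g t; apply (@ex_derive_continuous R_AbsRing R_NormedModule). }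
(* The majorant needs an explicit bounded primitive. It is the integrand plus
   [(C exp(-t/2) - t^s exp(-t)) / s], which is nonnegative by [Rpower_exp_bound]; integrating by
   parts leaves [t^s exp(-t) / s - (2 C / s) exp(-t/2)], of size at most [(C + 2 C) / s]. *)
apply (improper_exists _ _ _ positive_ends _
  (fun t => / s * (Rpower t s * exp (- t)) + - (2 * C / s) * exp (- t / 2))
  (fun t => / s * (s * (Rpower t (s - 1) * exp (- t)) - Rpower t s * exp (- t))
            + C / s * exp (- t / 2))
  (3 * C / s)).
- intros; now apply continuous_Gamma_integrand.
- intros t t0; pose proof (Rpower_exp_bound s t s0 t0) as B; fold C in B.
  assert (0 < Rpower t (s - 1) * exp (- t)).
  { apply Rmult_lt_0_compat; [apply Rpower_pos|apply exp_pos]. }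
  assert (0 < / s) by now apply Rinv_0_lt_compat.
  split; [lra|].
  replace (/ s * _ + _) with (Rpower t (s - 1) * exp (- t)
     + / s * (C * exp (- t / 2) - Rpower t s * exp (- t))) by (field; lra).
  assert (0 <= / s * (C * exp (- t / 2) - Rpower t s * exp (- t))) by (apply Rmult_le_pos; lra).
  lra.
- intros t t0; apply cont.
  apply (@ex_derive_plus R_AbsRing R_NormedModule).
  + apply ex_derive_scal, (@ex_derive_minus R_AbsRing R_NormedModule).
    * apply ex_derive_scal; eexists; now apply is_derive_Gamma_primitive.
    * eexists; now apply is_derive_Gamma_primitive.
  + auto_derive; trivial.
- intros t t0.
  apply (@is_derive_plus R_AbsRing R_NormedModule).
  + apply is_derive_scal; now apply is_derive_Gamma_primitive.
  + auto_derive; [trivial|unfold Rdiv; field; lra].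
- intros t t0; pose proof (Rpower_exp_bound s t s0 t0) as B; fold C in B.
  assert (0 < Rpower t s * exp (- t)).
  { apply Rmult_lt_0_compat; [apply Rpower_pos|apply exp_pos]. }
  pose proof (exp_pos (- t / 2)).
  assert (exp (- t / 2) <= 1).
  { rewrite <- exp_0; apply Rlt_le, exp_increasing; lra. }
  assert (0 < / s) by now apply Rinv_0_lt_compat.
  apply Rabs_le.
  replace (/ s * _ + _) with (/ s * (Rpower t s * exp (- t) - 2 * C * exp (- t / 2)))
    by (field; lra).
  replace (3 * C / s) with (/ s * (3 * C)) by (field; lra).
  replace (- (/ s * (3 * C))) with (/ s * (- (3 * C))) by ring.
  assert (C * exp (- t / 2) <= C) by nra.
  split; apply Rmult_le_compat_l; lra.
Qed.

Lemma Gamma_integral (s : R) :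
  0 < s ->
  is_RInt_gen (fun t => Rpower t (s - 1) * exp (- t)) (at_right 0) (Rbar_locally p_infty)
    (Gamma s).
Proof.
intros s0; apply improper_int_0infP; unfold Gamma; apply epsilon_spec.
destruct (Gamma_integral_exists s s0) as [l Hl].
exists l; now apply improper_int_0infP.
Qed.

Lemma Gamma_pos (s : R) : 0 < s -> 0 < Gamma s.
Proof.
intros s0; eapply (improper_pos _ _ _ positive_ends); [| |exact (Gamma_integral s s0)].
- intros; now apply continuous_Gamma_integrand.
- intros; apply Rmult_lt_0_compat; [apply Rpower_pos|apply exp_pos].
Qed.

Lemma Gamma_succ (s : R) : 0 < s -> Gamma (s + 1) = s * Gamma s.
Proof.
intros s0.
assert (H : is_RInt_gen
  (fun t => s * (Rpower t (s - 1) * exp (- t)) - Rpower t s * exp (- t))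
  (at_right 0) (Rbar_locally p_infty) (0 - 0)).
{ apply (improper_derive _ _ _ positive_ends (fun t => Rpower t s * exp (- t))).
  - intros; now apply is_derive_Gamma_primitive.
  - intros t t0; apply (@continuous_minus R_UniformSpace R_AbsRing R_NormedModule).
    + apply (@continuous_scal_r R_UniformSpace R_AbsRing R_NormedModule).
      now apply continuous_Gamma_integrand.
    + apply (@ex_derive_continuous R_AbsRing R_NormedModule).
      eexists; now apply is_derive_Gamma_primitive.
  - now apply filterlim_Rpower_exp_0.
  - now apply filterlim_Rpower_exp_infty. }
assert (s1 : 0 < s + 1) by lra.
pose proof (improper_plus _ _ _ _ _ _ H (Gamma_integral _ s1)) as K.
apply (improper_unique (at_right 0) (Rbar_locally p_infty) (fun t => s * (Rpower t (s - 1) * exp (- t))));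
  [|exact (improper_scal _ _ _ _ _ (Gamma_integral s s0))].
replace (Gamma (s + 1)) with (0 - 0 + Gamma (s + 1)) by ring.
refine (improper_ext _ _ _ positive_ends _ _ _ _ K).
intros t t0; simpl; replace (s + 1 - 1) with s by ring; ring.
Qed.

Lemma Gamma_1 : Gamma 1 = 1.
Proof.
apply (improper_unique (at_right 0) (Rbar_locally p_infty) (fun t => Rpower t (1 - 1) * exp (- t))).
{ apply Gamma_integral; lra. }
apply (improper_ext _ _ _ positive_ends (fun t => exp (- t))).
{ intros t t0; rewrite Rminus_diag_eq, Rpower_O; auto; ring. }
assert (E : exp (- 0) = 1) by (rewrite Ropp_0; apply exp_0).
assert (D : forall t, is_derive (fun t => - exp (- t)) t (exp (- t))).
{ intros t; auto_derive; [trivial|ring]. }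
replace 1 with (- 0 - - exp (- 0)) by (rewrite E; ring).
apply (improper_derive _ _ _ positive_ends (fun t => - exp (- t))).
- intros; apply D.
- intros; apply (@ex_derive_continuous R_AbsRing R_NormedModule); auto_derive; trivial.
- apply (filterlim_filter_le_1 (F := locally 0)); [apply filter_le_within|].
  apply (@ex_derive_continuous R_AbsRing R_NormedModule (fun t => - exp (- t))).
  eexists; apply D.
- apply (filterlim_comp _ _ _ (fun t => exp (- t)) Ropp _ (locally 0)); [|apply (filterlim_opp 0)].
  apply (filterlim_comp _ _ _ Ropp exp _ (Rbar_locally m_infty)); [|exact is_lim_exp_m].
  intros P [M HM]; exists (- M); intros x Hx; apply HM; lra.
Qed.

(* Hoelder's inequality in the only case needed: integrate [Rpower_tangent] with
   [l := I1 / I0]. *)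
Lemma improper_interpolation (D : R -> Prop) (Fa Fb : (R -> Prop) -> Prop)
    (FFa : ProperFilter Fa) (FFb : ProperFilter Fb) (phi m : R -> R) (s I0 I1 Is : R) :
  interval_ends D Fa Fb -> 0 <= s <= 1 ->
  (forall t, D t -> 0 < phi t) -> (forall t, D t -> 0 <= m t) -> 0 < I0 -> 0 < I1 ->
  is_RInt_gen m Fa Fb I0 -> is_RInt_gen (fun t => phi t * m t) Fa Fb I1 ->
  is_RInt_gen (fun t => Rpower (phi t) s * m t) Fa Fb Is ->
  Is <= Rpower (I1 / I0) s * I0.
Proof.
intros HD s01 Hphi Hm I0p I1p H0 H1 Hs.
set (l := I1 / I0).
assert (l0 : 0 < l) by (apply Rdiv_lt_0_compat; auto).
replace (Rpower l s * I0) with (Rpower l s * ((1 - s) * I0 + s / l * I1))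
  by (unfold l; field; lra).
refine (improper_le _ _ _ HD _ _ _ _ _ Hs (improper_scal _ _ _ (Rpower l s) _
  (improper_plus _ _ _ _ _ _ (improper_scal _ _ _ _ _ H0) (improper_scal _ _ _ (s / l) _ H1)))).
intros t Dt; simpl; specialize (Hphi t Dt); specialize (Hm t Dt).
pose proof (Rpower_tangent (phi t) l s Hphi l0 s01); pose proof (Rpower_pos (phi t) s).
split; [nra|].
replace (Rpower l s * _) with (Rpower l s * (1 - s + s / l * phi t) * m t) by ring.
now apply Rmult_le_compat_r.
Qed.

(** Log-convexity between [p] and [p + 1], where the two values have ratio [p]. *)
Lemma Gamma_le_Rpower (p s : R) :
  0 < p -> 0 <= s <= 1 -> Gamma (p + s) <= Rpower p s * Gamma p.
Proof.
intros p0 s01.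
assert (ps : 0 < p + s) by lra. assert (p1 : 0 < p + 1) by lra.
pose proof (Gamma_pos _ p0).
replace (Rpower p s) with (Rpower (Gamma (p + 1) / Gamma p) s)
  by (f_equal; rewrite Gamma_succ by auto; field; lra).
apply (improper_interpolation _ _ _ _ _ (fun t => t)
  (fun t => Rpower t (p - 1) * exp (- t)) s _ _ _ positive_ends); auto.
- intros; apply Rlt_le, Rmult_lt_0_compat; [apply Rpower_pos|apply exp_pos].
- now apply Gamma_pos.
- now apply Gamma_integral.
- refine (improper_ext _ _ _ positive_ends _ _ _ _ (Gamma_integral _ p1)).
  intros t t0; simpl; replace (p + 1 - 1) with p by ring.
  rewrite (Rpower_pred t p) by auto; ring.
- refine (improper_ext _ _ _ positive_ends _ _ _ _ (Gamma_integral _ ps)).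
  intros t t0; simpl; replace (p + s - 1) with (s + (p - 1)) by ring.
  rewrite Rpower_plus; ring.
Qed.

(** * The Beta integral *)

Definition beta_integrand (p q y : R) : R :=
  Rpower ((1 - y) / 2) (p - 1) * Rpower ((1 + y) / 2) (q - 1).

(* This is [2 * B(p, q)]: the substitution [t = (1 - y) / 2] is not performed. *)
Definition beta_integral (p q : R) : R :=
  RInt_gen (beta_integrand p q) (at_right (-1)) (at_left 1).

Lemma unit_ends : interval_ends (fun t => -1 < t < 1) (at_right (-1)) (at_left 1).
Proof. apply bounded_interval_ends; lra. Qed.

Lemma is_derive_Rpower_half_minus (y s : R) :
  y < 1 -> is_derive (fun y => Rpower ((1 - y) / 2) s) y (- (s / 2) * Rpower ((1 - y) / 2) (s - 1)).
Proof.
intros y1.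
replace (- (s / 2) * _) with (scal (- / 2) (s * Rpower ((1 - y) / 2) (s - 1)))
  by (unfold scal; simpl; unfold mult; simpl; field).
apply (is_derive_comp (fun u => Rpower u s) (fun y => (1 - y) / 2)).
- apply is_derive_Rpower; lra.
- auto_derive; [trivial|field].
Qed.

Lemma is_derive_Rpower_half_plus (y s : R) :
  -1 < y -> is_derive (fun y => Rpower ((1 + y) / 2) s) y (s / 2 * Rpower ((1 + y) / 2) (s - 1)).
Proof.
intros y1.
replace (s / 2 * _) with (scal (/ 2) (s * Rpower ((1 + y) / 2) (s - 1)))
  by (unfold scal; simpl; unfold mult; simpl; field).
apply (is_derive_comp (fun u => Rpower u s) (fun y => (1 + y) / 2)).
- apply is_derive_Rpower; lra.
- auto_derive; [trivial|field].
Qed.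

Lemma is_derive_beta_primitive (p q y : R) :
  -1 < y < 1 ->
  is_derive (beta_integrand (p + 1) (q + 1)) y
    (- (p / 2) * beta_integrand p q y + (p + q) / 2 * beta_integrand (p + 1) q y).
Proof.
intros [y1 y2]; unfold beta_integrand.
replace (p + 1 - 1) with p by ring; replace (q + 1 - 1) with q by ring.
generalize (is_derive_mult _ _ _ _ _ (is_derive_Rpower_half_minus y p y2)
  (is_derive_Rpower_half_plus y q y1) Rmult_comm).
unfold plus, mult; simpl; intros H.
replace (_ + _) with
  (- (p / 2) * Rpower ((1 - y) / 2) (p - 1) * Rpower ((1 + y) / 2) q +
   Rpower ((1 - y) / 2) p * (q / 2 * Rpower ((1 + y) / 2) (q - 1))); [exact H|].
rewrite (Rpower_pred ((1 - y) / 2) p), (Rpower_pred ((1 + y) / 2) q) by lra; field.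
Qed.

Lemma continuous_beta_integrand (p q y : R) :
  -1 < y < 1 -> continuous (beta_integrand p q) y.
Proof.
intros Hy; apply (@ex_derive_continuous R_AbsRing R_NormedModule).
pose proof (is_derive_beta_primitive (p - 1) (q - 1) y Hy) as H.
replace (p - 1 + 1) with p in H by ring; replace (q - 1 + 1) with q in H by ring.
eexists; exact H.
Qed.

Lemma beta_integrand_pos (p q y : R) : 0 < beta_integrand p q y.
Proof. apply Rmult_lt_0_compat; apply Rpower_pos. Qed.

(** The exponent may have either sign, so the maximum on [[1/2, 1]] is at one end or the other; the
    sum of the two end values covers both. *)
Lemma Rpower_half_le (q y : R) : / 2 <= y <= 1 -> Rpower y q <= 1 + Rpower (/ 2) q.
Proof.
intros Hy; pose proof (Rpower_pos (/ 2) q).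
destruct (Rle_dec 0 q).
- assert (Rpower y q <= Rpower 1 q) by (apply Rle_Rpower_l; lra).
  rewrite Rpower_one in H0; lra.
- assert (Rpower y q <= Rpower (/ 2) q); [|lra].
  replace q with (- - q) by ring; rewrite !(Rpower_Ropp _ (- q)).
  apply Rinv_le_contravar; [apply Rpower_pos|apply Rle_Rpower_l; lra].
Qed.

Lemma beta_integral_exists (p q : R) :
  0 < p -> 0 < q ->
  exists l, is_RInt_gen (beta_integrand p q) (at_right (-1)) (at_left 1) l.
Proof.
intros p0 q0.
set (A := 1 + Rpower (/ 2) (q - 1)); set (B := 1 + Rpower (/ 2) (p - 1)).
assert (A0 : 0 < A) by (pose proof (Rpower_pos (/ 2) (q - 1)); unfold A; lra).
assert (B0 : 0 < B) by (pose proof (Rpower_pos (/ 2) (p - 1)); unfold B; lra).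
assert (A1 : 0 < 2 * A / p) by (apply Rdiv_lt_0_compat; lra).
assert (B1 : 0 < 2 * B / q) by (apply Rdiv_lt_0_compat; lra).
(* On each half of the interval the factor belonging to the far end is bounded, by [A] or by [B].
   The sum of the two one-sided majorants serves on both halves and has an elementary primitive. *)
apply (improper_exists _ _ _ unit_ends _
  (fun y => - (2 * A / p) * Rpower ((1 - y) / 2) p + 2 * B / q * Rpower ((1 + y) / 2) q)
  (fun y => A * Rpower ((1 - y) / 2) (p - 1) + B * Rpower ((1 + y) / 2) (q - 1))
  (2 * A / p + 2 * B / q)).
- intros; now apply continuous_beta_integrand.
- intros y Hy; pose proof (beta_integrand_pos p q y); split; [lra|].
  unfold beta_integrand.
  pose proof (Rpower_pos ((1 - y) / 2) (p - 1)); pose proof (Rpower_pos ((1 + y) / 2) (q - 1)).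
  destruct (Rle_dec 0 y).
  + assert (Rpower ((1 + y) / 2) (q - 1) <= A) by (apply Rpower_half_le; lra); nra.
  + assert (Rpower ((1 - y) / 2) (p - 1) <= B) by (apply Rpower_half_le; lra); nra.
- intros y Hy; apply (@ex_derive_continuous R_AbsRing R_NormedModule).
  apply (@ex_derive_plus R_AbsRing R_NormedModule); apply ex_derive_scal; eexists.
  + apply is_derive_Rpower_half_minus; lra.
  + apply is_derive_Rpower_half_plus; lra.
- intros y Hy.
  replace (A * _) with (- (2 * A / p) * (- (p / 2) * Rpower ((1 - y) / 2) (p - 1))) by (field; lra).
  replace (B * _) with ((2 * B / q) * (q / 2 * Rpower ((1 + y) / 2) (q - 1))) by (field; lra).
  apply (@is_derive_plus R_AbsRing R_NormedModule); apply is_derive_scal.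
  + apply is_derive_Rpower_half_minus; lra.
  + apply is_derive_Rpower_half_plus; lra.
- intros y Hy.
  assert (0 < Rpower ((1 - y) / 2) p < 1) by (apply Rpower_lt_1; lra).
  assert (0 < Rpower ((1 + y) / 2) q < 1) by (apply Rpower_lt_1; lra).
  apply Rabs_le; split; nra.
Qed.

Lemma beta_integral_correct (p q : R) :
  0 < p -> 0 < q ->
  is_RInt_gen (beta_integrand p q) (at_right (-1)) (at_left 1) (beta_integral p q).
Proof.
intros p0 q0.
exact (RInt_gen_correct (V := R_CompleteNormedModule) _ (beta_integral_exists p q p0 q0)).
Qed.

Lemma beta_integral_pos (p q : R) : 0 < p -> 0 < q -> 0 < beta_integral p q.
Proof.
intros p0 q0; eapply (improper_pos _ _ _ unit_ends);
  [| |exact (beta_integral_correct p q p0 q0)]; intros.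
- now apply continuous_beta_integrand.
- apply beta_integrand_pos.
Qed.

Lemma filterlim_half_minus : filterlim (fun y => (1 - y) / 2) (at_left 1) (at_right 0).
Proof.
intros P [[e e0] HP]; exists (mkposreal _ e0); intros y Hy y1; apply HP.
- change (Rabs ((1 - y) / 2 - 0) < e); change (Rabs (y - 1) < e) in Hy.
  apply Rabs_def2 in Hy; apply Rabs_def1; lra.
- lra.
Qed.

Lemma filterlim_half_plus : filterlim (fun y => (1 + y) / 2) (at_right (-1)) (at_right 0).
Proof.
intros P [[e e0] HP]; exists (mkposreal _ e0); intros y Hy y1; apply HP.
- change (Rabs ((1 + y) / 2 - 0) < e); change (Rabs (y - -1) < e) in Hy.
  apply Rabs_def2 in Hy; apply Rabs_def1; lra.
- lra.
Qed.

Lemma filterlim_beta_primitive (p q : R) :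
  0 < p -> 0 < q ->
  filterlim (beta_integrand (p + 1) (q + 1)) (at_right (-1)) (locally 0) /\
  filterlim (beta_integrand (p + 1) (q + 1)) (at_left 1) (locally 0).
Proof.
intros p0 q0; unfold beta_integrand.
replace (p + 1 - 1) with p by ring; replace (q + 1 - 1) with q by ring.
split.
- apply (filterlim_0_squeeze _ _ _ (fun y => Rpower ((1 + y) / 2) q) 1).
  + eapply filter_imp; [|apply (at_right_in (-1) 1); lra]; intros y Hy.
    assert (0 < Rpower ((1 - y) / 2) p < 1) by (apply Rpower_lt_1; lra).
    assert (0 < Rpower ((1 + y) / 2) q < 1) by (apply Rpower_lt_1; lra).
    simpl; split; nra.
  + exact (filterlim_comp _ _ _ _ _ _ _ _ filterlim_half_plus (filterlim_Rpower_0 q q0)).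
- apply (filterlim_0_squeeze _ _ _ (fun y => Rpower ((1 - y) / 2) p) 1).
  + eapply filter_imp; [|apply (at_left_in 1 (-1)); lra]; intros y Hy.
    assert (0 < Rpower ((1 - y) / 2) p < 1) by (apply Rpower_lt_1; lra).
    assert (0 < Rpower ((1 + y) / 2) q < 1) by (apply Rpower_lt_1; lra).
    simpl; split; nra.
  + exact (filterlim_comp _ _ _ _ _ _ _ _ filterlim_half_minus (filterlim_Rpower_0 p p0)).
Qed.

Lemma beta_integral_succ (p q : R) :
  0 < p -> 0 < q -> beta_integral (p + 1) q = p / (p + q) * beta_integral p q.
Proof.
intros p0 q0; assert (p1 : 0 < p + 1) by lra.
destruct (filterlim_beta_primitive p q p0 q0) as [La Lb].
assert (H : is_RInt_gen
  (fun y => - (p / 2) * beta_integrand p q y + (p + q) / 2 * beta_integrand (p + 1) q y)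
  (at_right (-1)) (at_left 1) (0 - 0)).
{ apply (improper_derive _ _ _ unit_ends (beta_integrand (p + 1) (q + 1))); auto.
  - intros; now apply is_derive_beta_primitive.
  - intros y Hy; apply (@continuous_plus R_UniformSpace R_AbsRing R_NormedModule);
      apply (@continuous_scal_r R_UniformSpace R_AbsRing R_NormedModule);
      now apply continuous_beta_integrand. }
pose proof (improper_plus _ _ _ _ _ _
  (improper_scal _ _ _ (- (p / 2)) _ (beta_integral_correct p q p0 q0))
  (improper_scal _ _ _ ((p + q) / 2) _ (beta_integral_correct _ _ p1 q0))) as K.
pose proof (improper_unique _ _ _ _ _ H K) as E.
apply Rmult_eq_reg_l with ((p + q) / 2); [|lra].
replace ((p + q) / 2 * (p / (p + q) * beta_integral p q)) with (p / 2 * beta_integral p q)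
  by (field; lra); lra.
Qed.

Lemma beta_integral_1 (q : R) : 0 < q -> beta_integral 1 q = 2 / q.
Proof.
intros q0; assert (p1 : 0 < 1) by lra.
apply (improper_unique (at_right (-1)) (at_left 1) _ _ _ (beta_integral_correct 1 q p1 q0)).
apply (improper_ext _ _ _ unit_ends (fun y => Rpower ((1 + y) / 2) (q - 1))).
{ intros y Hy; unfold beta_integrand.
  rewrite (Rminus_diag_eq 1 1), Rpower_O by lra; ring. }
assert (D : forall y, -1 < y ->
  is_derive (fun y => 2 / q * Rpower ((1 + y) / 2) q) y (Rpower ((1 + y) / 2) (q - 1))).
{ intros y Hy.
  replace (Rpower _ (q - 1)) with (2 / q * (q / 2 * Rpower ((1 + y) / 2) (q - 1))) by (field; lra).
  apply is_derive_scal, is_derive_Rpower_half_plus; lra. }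
replace (2 / q) with (2 / q * Rpower ((1 + 1) / 2) q - 2 / q * 0).
2:{ replace ((1 + 1) / 2) with 1 by field; rewrite Rpower_one; ring. }
apply (improper_derive _ _ _ unit_ends (fun y => 2 / q * Rpower ((1 + y) / 2) q)).
- intros; apply D; lra.
- intros; apply (@ex_derive_continuous R_AbsRing R_NormedModule).
  eexists; apply is_derive_Rpower_half_plus; lra.
- exact (filterlim_comp _ _ _ _ _ _ _ _
    (filterlim_comp _ _ _ _ _ _ _ _ filterlim_half_plus (filterlim_Rpower_0 q q0))
    (filterlim_scal_r (2 / q) 0)).
- apply (filterlim_filter_le_1 (F := locally 1)); [apply filter_le_within|].
  apply (@ex_derive_continuous R_AbsRing R_NormedModule (fun y => 2 / q * Rpower ((1 + y) / 2) q)).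
  eexists; apply D; lra.
Qed.

Lemma beta_integral_le_Rpower (p q s : R) :
  0 < p -> 0 < q -> 0 <= s <= 1 ->
  beta_integral (p + s) q <= Rpower (p / (p + q)) s * beta_integral p q.
Proof.
intros p0 q0 s01.
assert (ps : 0 < p + s) by lra. assert (p1 : 0 < p + 1) by lra.
pose proof (beta_integral_pos p q p0 q0).
replace (Rpower (p / (p + q)) s) with (Rpower (beta_integral (p + 1) q / beta_integral p q) s)
  by (f_equal; rewrite beta_integral_succ by auto; field; lra).
apply (improper_interpolation _ _ _ _ _ (fun y => (1 - y) / 2)
  (beta_integrand p q) s _ _ _ unit_ends); auto.
- intros; lra.
- intros; apply Rlt_le, beta_integrand_pos.
- now apply beta_integral_pos.
- now apply beta_integral_correct.
- refine (improper_ext _ _ _ unit_ends _ _ _ _ (beta_integral_correct _ _ p1 q0)).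
  intros y Hy; simpl; unfold beta_integrand; replace (p + 1 - 1) with p by ring.
  rewrite (Rpower_pred ((1 - y) / 2) p) by lra; ring.
- refine (improper_ext _ _ _ unit_ends _ _ _ _ (beta_integral_correct _ _ ps q0)).
  intros y Hy; simpl; unfold beta_integrand; replace (p + s - 1) with (s + (p - 1)) by ring.
  rewrite Rpower_plus; ring.
Qed.

(** This is [(y / x)^s <= y / x] for [y / x >= 1], cleared of denominators. *)
Lemma Rpower_frac_le (x y s : R) : 0 < x <= y -> 0 <= s <= 1 -> Rpower y s * x <= Rpower x s * y.
Proof.
intros xy s01.
rewrite <- (Rpower_1 x) at 1 by lra; rewrite <- (Rpower_1 y) at 2 by lra.
replace 1 with (s + (1 - s)) by ring; rewrite !Rpower_plus.
assert (Rpower x (1 - s) <= Rpower y (1 - s)) by (apply Rle_Rpower_l; lra).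
pose proof (Rpower_pos x s); pose proof (Rpower_pos y s).
replace (Rpower y s * (Rpower x s * Rpower x (1 - s)))
  with ((Rpower x s * Rpower y s) * Rpower x (1 - s)) by ring.
replace (Rpower x s * (Rpower y s * Rpower y (1 - s)))
  with ((Rpower x s * Rpower y s) * Rpower y (1 - s)) by ring.
apply Rmult_le_compat_l; nra.
Qed.

(* Both [Gamma] and [beta_integral] are log-convex in [p]; comparing an argument
   [M + s] with the neighbouring integer arguments determines the ratio up to
   [1 + O(1/M)]. *)
Lemma beta_Gamma_near_integer (M q s : R) :
  0 < M -> 0 < q -> 0 <= s <= 1 ->
  beta_integral M q * Gamma (M + q) = 2 * Gamma M * Gamma q ->
  let u := beta_integral (M + s) q * Gamma (M + s + q) in
  let v := 2 * Gamma (M + s) * Gamma q in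
  M * u <= (M + s) * v /\ M * v <= (M + s) * u.
Proof.
intros M0 q0 s01 E u v.
assert (Ms : 0 < M + s) by lra. assert (Mq : 0 < M + q) by lra.
assert (Msq : 0 < M + s + q) by lra.
pose proof (Gamma_pos _ M0) as G0; pose proof (Gamma_pos _ Ms) as G1.
pose proof (Gamma_pos _ q0) as Gq; pose proof (Gamma_pos _ Mq) as K0.
pose proof (Gamma_pos _ Msq) as K1.
pose proof (beta_integral_pos _ _ M0 q0) as B0; pose proof (beta_integral_pos _ _ Ms q0) as B1.
assert (s01' : 0 <= 1 - s <= 1) by lra.
assert (G_up := Gamma_le_Rpower M s M0 s01).
assert (G_dn := Gamma_le_Rpower (M + s) (1 - s) Ms s01').
assert (K_up := Gamma_le_Rpower (M + q) s Mq s01).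
assert (K_dn := Gamma_le_Rpower (M + s + q) (1 - s) Msq s01').
assert (B_up := beta_integral_le_Rpower M q s M0 q0 s01).
assert (B_dn := beta_integral_le_Rpower (M + s) q (1 - s) Ms q0 s01').
replace (M + s + (1 - s)) with (M + 1) in * by ring.
replace (M + s + q + (1 - s)) with (M + q + 1) in K_dn by ring.
replace (M + q + s) with (M + s + q) in K_up by ring.
rewrite Gamma_succ in G_dn, K_dn by auto.
rewrite beta_integral_succ in B_dn by auto.
set (G := Gamma M) in *; set (G' := Gamma (M + s)) in *; set (Q := Gamma q) in *.
set (K := Gamma (M + q)) in *; set (K' := Gamma (M + s + q)) in *.
set (B := beta_integral M q) in *; set (B' := beta_integral (M + s) q) in *.
assert (P1 : Rpower (M / (M + q)) s * Rpower (M + q) s = Rpower M s).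
{ rewrite Rpower_mult_distr; [f_equal; field; lra|apply Rdiv_lt_0_compat; lra|lra]. }
assert (P2 : Rpower ((M + s) / (M + s + q)) (1 - s) * Rpower (M + s + q) (1 - s)
             = Rpower (M + s) (1 - s)).
{ rewrite Rpower_mult_distr; [f_equal; field; lra|apply Rdiv_lt_0_compat; lra|lra]. }
assert (P3 : Rpower M s * Rpower M (1 - s) = M).
{ rewrite <- Rpower_plus; replace (s + (1 - s)) with 1 by ring; now apply Rpower_1. }
assert (P4 := Rpower_frac_le M (M + s) (1 - s) ltac:(lra) s01').
set (m1 := Rpower M (1 - s)) in *; set (ms := Rpower M s) in *.
set (r := Rpower (M + s) (1 - s)) in *.
assert (m10 : 0 < m1) by apply Rpower_pos. assert (ms0 : 0 < ms) by apply Rpower_pos.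
assert (r0 : 0 < r) by apply Rpower_pos.
(* From [M] to [M + s] the quantity [u] grows by at most [M^s], and from [M + s] to [M + 1] the
   quantity [v] grows by at most [(M + s)^(1 - s)]; hence [U2]. The powers of [M + q] cancel between
   the Beta and Gamma factors of [u] by [P1] and [P2]. [L1] and [L2] exchange the roles of [u] and
   [v], and [P4] finally trades the ratio of powers for [(M + s) / M]. *)
assert (U1 : u <= ms * (2 * G * Q)).
{ unfold u; rewrite <- E, <- P1.
  replace (_ * _ * (B * K)) with ((Rpower (M / (M + q)) s * B) * (Rpower (M + q) s * K)) by ring.
  apply Rmult_le_compat; lra. }
assert (U2 : m1 * u <= r * v).
{ apply Rle_trans with (m1 * (ms * (2 * G * Q))); [apply Rmult_le_compat_l; lra|].
  replace (m1 * (ms * (2 * G * Q))) with (ms * m1 * G * (2 * Q)) by ring; rewrite P3.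
  unfold v; replace (r * (2 * G' * Q)) with (r * G' * (2 * Q)) by ring.
  apply Rmult_le_compat_r; lra. }
assert (L1 : M * (B * K) <= r * u).
{ unfold u; rewrite <- P2.
  replace (M * (B * K)) with ((M / (M + q) * B) * ((M + q) * K)) by (field; lra).
  replace (_ * _ * (B' * K')) with
    ((Rpower ((M + s) / (M + s + q)) (1 - s) * B') * (Rpower (M + s + q) (1 - s) * K')) by ring.
  apply Rmult_le_compat; try lra.
  - apply Rmult_le_pos; [apply Rlt_le, Rdiv_lt_0_compat; lra|lra].
  - apply Rmult_le_pos; lra. }
assert (L2 : m1 * v <= r * u).
{ apply Rle_trans with (2 := L1); rewrite E, <- P3; unfold v.
  replace (m1 * (2 * G' * Q)) with (G' * (2 * Q * m1)) by ring.
  replace (ms * m1 * (2 * G * Q)) with (ms * G * (2 * Q * m1)) by ring.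
  apply Rmult_le_compat_r; [|lra]; apply Rmult_le_pos; lra. }
assert (u0 : 0 < u) by (unfold u; nra). assert (v0 : 0 < v) by (unfold v; nra).
split; apply Rmult_le_reg_l with m1; auto.
- replace (m1 * (M * u)) with (M * (m1 * u)) by ring.
  apply Rle_trans with (M * (r * v)); [apply Rmult_le_compat_l; lra|]; nra.
- replace (m1 * (M * v)) with (M * (m1 * v)) by ring.
  apply Rle_trans with (M * (r * u)); [apply Rmult_le_compat_l; lra|]; nra.
Qed.

Lemma beta_Gamma_shift (p q : R) :
  0 < p -> 0 < q ->
  beta_integral (p + 1) q * Gamma (p + 1 + q) = 2 * Gamma (p + 1) * Gamma q <->
  beta_integral p q * Gamma (p + q) = 2 * Gamma p * Gamma q.
Proof.
intros p0 q0.
replace (p + 1 + q) with (p + q + 1) by ring.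
rewrite beta_integral_succ, !Gamma_succ by lra.
replace (_ * _ * _) with (p * (beta_integral p q * Gamma (p + q))) at 1 by (field; lra).
replace (2 * (p * Gamma p) * Gamma q) with (p * (2 * Gamma p * Gamma q)) by ring.
split; [intros H; apply Rmult_eq_reg_l with p; lra|now intros ->].
Qed.

Lemma beta_Gamma_shift_nat (p q : R) (n : nat) :
  0 < p -> 0 < q ->
  beta_integral (p + INR n) q * Gamma (p + INR n + q) = 2 * Gamma (p + INR n) * Gamma q <->
  beta_integral p q * Gamma (p + q) = 2 * Gamma p * Gamma q.
Proof.
intros p0 q0; induction n as [|n IH].
- simpl; now rewrite Rplus_0_r.
- rewrite S_INR, <- Rplus_assoc, <- IH; apply beta_Gamma_shift; auto.
  pose proof (pos_INR n); lra.
Qed.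

Lemma beta_Gamma_1 (q : R) :
  0 < q -> beta_integral 1 q * Gamma (1 + q) = 2 * Gamma 1 * Gamma q.
Proof.
intros q0; rewrite beta_integral_1, Gamma_1, (Rplus_comm 1), Gamma_succ by lra; field; lra.
Qed.

Lemma Rle_of_archimedean (u v : R) :
  (forall n : nat, INR (S n) * (u - v) <= v) -> u <= v.
Proof.
intros H; apply Rnot_lt_le; intros vu.
destruct (INR_archimed (u - v) v) as [n Hn]; [lra|].
specialize (H n); rewrite S_INR in H; nra.
Qed.

(** Shifting [p] by an integer multiplies both sides by the same factor, so their ratio at [p] in
    [(0, 1]] can be read off at [n + 1 + p]. There it differs from the known ratio 1 at the integer
    [n + 1] by a factor of at most [1 + p / (n + 1)], in either direction, for every [n]. Larger [p]
    are shifted down into [(0, 1]]. *)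
Lemma beta_Gamma (p q : R) :
  0 < p -> 0 < q -> beta_integral p q * Gamma (p + q) = 2 * Gamma p * Gamma q.
Proof.
assert (Hle1 : forall p q, 0 < p <= 1 -> 0 < q ->
  beta_integral p q * Gamma (p + q) = 2 * Gamma p * Gamma q).
{ clear p q; intros p q p01 q0; assert (p0 : 0 < p) by lra.
  set (u := beta_integral p q * Gamma (p + q)); set (v := 2 * Gamma p * Gamma q).
  assert (v0 : 0 < v).
  { pose proof (Gamma_pos _ p0); pose proof (Gamma_pos _ q0); unfold v; nra. }
  assert (pq : 0 < p + q) by lra.
  assert (u0 : 0 < u).
  { pose proof (Gamma_pos _ pq); pose proof (beta_integral_pos _ _ p0 q0); unfold u; nra. }
  assert (K : forall n, exists c, 0 < c /\ 
    beta_integral (p + INR n) q * Gamma (p + INR n + q) = c * u /\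
    2 * Gamma (p + INR n) * Gamma q = c * v).
  { induction n as [|n (c & c0 & E1 & E2)].
    - exists 1; simpl; rewrite Rplus_0_r; unfold u, v; repeat split; try lra.
    - pose proof (pos_INR n); assert (0 < p + INR n) by lra.
      exists ((p + INR n) * c); split; [nra|].
      rewrite S_INR, <- Rplus_assoc.
      replace (p + INR n + 1 + q) with (p + INR n + q + 1) by ring.
      rewrite beta_integral_succ, !Gamma_succ by lra; split.
      + rewrite (Rmult_assoc _ c u), <- E1; field; lra.
      + rewrite (Rmult_assoc _ c v), <- E2; ring. }
  assert (B : forall n, INR (S n) * u <= (INR (S n) + p) * v /\
                        INR (S n) * v <= (INR (S n) + p) * u).
  { intros n; destruct (K (S n)) as (c & c0 & E1 & E2).
    assert (M0 : 0 < INR (S n)) by (apply lt_0_INR; lia).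
    assert (E : beta_integral (INR (S n)) q * Gamma (INR (S n) + q)
                = 2 * Gamma (INR (S n)) * Gamma q).
    { rewrite S_INR, Rplus_comm; apply beta_Gamma_shift_nat; try lra.
      now apply beta_Gamma_1. }
    assert (p01' : 0 <= p <= 1) by lra.
    destruct (beta_Gamma_near_integer _ q p M0 q0 p01' E) as [H1 H2].
    rewrite (Rplus_comm _ p), E1, E2 in H1, H2; rewrite (Rplus_comm _ p).
    split; apply Rmult_le_reg_l with c; auto; lra. }
  apply Rle_antisym; apply Rle_of_archimedean; intros n; destruct (B n); nra. }
intros p0 q0; destruct (INR_archimed 1 p) as [n Hn]; [lra|]; rewrite Rmult_1_r in Hn.
revert p p0 Hn; induction n as [|n IH]; intros p p0 Hn; [simpl in Hn; lra|].
rewrite S_INR in Hn; destruct (Rle_dec p 1); [apply Hle1; lra|].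
replace p with (p - 1 + 1) by ring; apply beta_Gamma_shift; try lra.
apply IH; lra.
Qed.

(** * Fractional integrals of monomials *)

Lemma is_derive_frac_primitive (mu x y : R) (k : nat) :
  y < x ->
  is_derive (fun y => - (Rpower (x - y) mu * (1 + y) ^ k)) y
    (mu * (Rpower (x - y) (mu - 1) * (1 + y) ^ k)
     - INR k * (Rpower (x - y) mu * (1 + y) ^ pred k)).
Proof.
intros yx.
assert (D1 : is_derive (fun y => Rpower (x - y) mu) y (- (mu * Rpower (x - y) (mu - 1)))).
{ replace (- _) with (scal (- 1) (mu * Rpower (x - y) (mu - 1)))
    by (unfold scal; simpl; unfold mult; simpl; ring).
  apply (is_derive_comp (fun u => Rpower u mu) (fun y => x - y)).
  - apply is_derive_Rpower; lra.
  - auto_derive; [trivial|ring]. }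
assert (D2 : is_derive (fun y => (1 + y) ^ k) y (INR k * (1 + y) ^ pred k)).
{ auto_derive; [trivial|ring]. }
generalize (is_derive_opp _ _ _ (is_derive_mult _ _ _ _ _ D1 D2 Rmult_comm)).
unfold opp, plus, mult; simpl; intros H.
replace (_ - _) with
  (- (- (mu * Rpower (x - y) (mu - 1)) * (1 + y) ^ k
      + Rpower (x - y) mu * (INR k * (1 + y) ^ pred k))) by ring.
exact H.
Qed.

Lemma continuous_frac_integrand (mu x y : R) (k : nat) :
  y < x -> continuous (fun y => Rpower (x - y) mu * (1 + y) ^ k) y.
Proof.
intros yx; apply (@ex_derive_continuous R_AbsRing R_NormedModule).
eapply ex_derive_ext; [|apply (@ex_derive_opp R_AbsRing R_NormedModule);
  eexists; exact (is_derive_frac_primitive mu x y k yx)].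
intros t; unfold opp; simpl; ring.
Qed.

(** The boundary term at [-1] survives only for [k = 0], which [0 ^ k] records. In that case the
    term with [pred 0] carries the coefficient 0. *)
Lemma frac_integral_by_parts (mu x : R) (k : nat) :
  0 < mu -> -1 < x ->
  is_RInt_gen (fun y => mu * (Rpower (x - y) (mu - 1) * (1 + y) ^ k)
                        - INR k * (Rpower (x - y) mu * (1 + y) ^ pred k))
    (at_right (-1)) (at_left x) (Rpower (1 + x) mu * 0 ^ k).
Proof.
intros mu0 x1.
replace (Rpower (1 + x) mu * 0 ^ k) with
  (- (0 * (1 + x) ^ k) - - (Rpower (x - -1) mu * (1 + -1) ^ k)).
2:{ replace (x - -1) with (1 + x) by ring; replace (1 + -1) with 0 by ring; ring. }
apply (improper_derive _ _ _ (bounded_interval_ends (-1) x x1)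
  (fun y => - (Rpower (x - y) mu * (1 + y) ^ k))).
- intros y Hy; apply is_derive_frac_primitive; lra.
- intros y Hy; apply (@continuous_minus R_UniformSpace R_AbsRing R_NormedModule);
    apply (@continuous_scal_r R_UniformSpace R_AbsRing R_NormedModule);
    apply continuous_frac_integrand; lra.
- apply (filterlim_filter_le_1 (F := locally (-1))); [apply filter_le_within|].
  apply (@ex_derive_continuous R_AbsRing R_NormedModule
          (fun y => - (Rpower (x - y) mu * (1 + y) ^ k))).
  eexists; apply is_derive_frac_primitive; lra.
- apply (filterlim_comp _ _ _ (fun y => Rpower (x - y) mu * (1 + y) ^ k) Ropp _
    (locally (0 * (1 + x) ^ k))); [|apply (filterlim_opp (0 * (1 + x) ^ k))].
  refine (filterlim_comp_2 (fun y => Rpower (x - y) mu) (fun y => (1 + y) ^ k) Rmult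
    _ _ (filterlim_mult 0 ((1 + x) ^ k))).
  + apply (filterlim_comp _ _ _ (fun y => x - y) (fun t => Rpower t mu) _ (at_right 0));
      [|now apply filterlim_Rpower_0].
    intros P [[e e0] HP]; exists (mkposreal _ e0); intros y Hy yx; apply HP; [|lra].
    change (Rabs (x - y - 0) < e); change (Rabs (y - x) < e) in Hy.
    apply Rabs_def2 in Hy; apply Rabs_def1; lra.
  + apply (filterlim_filter_le_1 (F := locally x)); [apply filter_le_within|].
    apply (@ex_derive_continuous R_AbsRing R_NormedModule (fun y => (1 + y) ^ k)).
    auto_derive; trivial.
Qed.

Lemma frac_integral_monomial (mu x : R) (k : nat) :
  0 < mu -> -1 < x ->
  is_RInt_gen (fun y => Rpower (x - y) (mu - 1) * (1 + y) ^ k) (at_right (-1)) (at_left x)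
    (Gamma mu * INR (fact k) / Gamma (INR k + mu + 1) * Rpower (1 + x) mu * (1 + x) ^ k).
Proof.
intros mu0 x1.
assert (Gk : forall k : nat, 0 < Gamma (INR k + mu + 1)).
{ intros j; apply Gamma_pos; pose proof (pos_INR j); lra. }
induction k as [|k IH].
- pose proof (improper_scal _ _ _ (/ mu) _ (frac_integral_by_parts mu x 0 mu0 x1)) as H.
  replace (_ / _ * _ * _) with (/ mu * (Rpower (1 + x) mu * 0 ^ 0)).
  2:{ simpl; rewrite Rplus_0_l, Gamma_succ by auto; pose proof (Gamma_pos _ mu0); field; lra. }
  refine (improper_ext _ _ _ (bounded_interval_ends (-1) x x1) _ _ _ _ H).
  intros y Hy; simpl; field; lra.
- pose proof (pos_INR k).
  (* As [x - y = (1 + x) - (1 + y)], the term with exponent [mu] splits into the integrals of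
     degrees [k] and [k + 1] with exponent [mu - 1]. Collecting degree [k + 1] produces the divisor
     [mu + k + 1]. *)
  pose proof (improper_scal _ _ _ (/ (mu + INR k + 1)) _
    (improper_plus _ _ _ _ _ _ (frac_integral_by_parts mu x (S k) mu0 x1)
    (improper_scal _ _ _ ((INR k + 1) * (1 + x)) _ IH))) as H1.
  replace (_ / _ * _ * _) with (/ (mu + INR k + 1) * (Rpower (1 + x) mu * 0 ^ S k +
    (INR k + 1) * (1 + x) * (Gamma mu * INR (fact k) / Gamma (INR k + mu + 1) *
    Rpower (1 + x) mu * (1 + x) ^ k))).
  2:{ rewrite S_INR, fact_simpl, mult_INR, S_INR, <- !tech_pow_Rmult.
      replace (INR k + 1 + mu + 1) with (INR k + mu + 1 + 1) by ring.
      rewrite (Gamma_succ (INR k + mu + 1)) by lra; specialize (Gk k); field; lra. }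
  refine (improper_ext _ _ _ (bounded_interval_ends (-1) x x1) _ _ _ _ H1).
  intros y Hy; rewrite S_INR; simpl pred; simpl pow.
  rewrite (Rpower_pred (x - y) mu) by lra; field; lra.
Qed.

Module JacobiPoly.
Import all_boot all_order all_algebra ring lra.
Import Order.TTheory GRing.Theory Num.Theory.
Local Open Scope ring_scope.
Set Implicit Arguments.
Unset Strict Implicit.
Unset Printing Implicit Defensive.

(** * Jacobi polynomials in the variable [z = (1 - x) / 2] *)

Section Jacobi.
Variable F : realFieldType.
Implicit Types (a b c x : F) (n k : nat) (p q : {poly F}).

Definition pochr a k : F := \prod_(i < k) (a + i%:R).

Lemma pochr0 a : pochr a 0 = 1.
Proof. by rewrite /pochr big_ord0. Qed.

Lemma pochrS a k : pochr a k.+1 = pochr a k * (a + k%:R).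
Proof. by rewrite /pochr big_ord_recr. Qed.

Lemma pochrSl a k : pochr a k.+1 = a * pochr (a + 1) k.
Proof.
rewrite /pochr big_ord_recl addr0; congr (_ * _); apply: eq_bigr => i _ /=.
by rewrite /bump add1n -natr1; ring.
Qed.

Lemma pochr_gt0 a k : 0 < a -> 0 < pochr a k.
Proof. by move=> a0; apply: prodr_gt0 => i _; rewrite ltr_wpDr. Qed.

Lemma pochr_neq0 a k : 0 < a -> pochr a k != 0.
Proof. by move=> a0; rewrite gt_eqF ?pochr_gt0. Qed.

Lemma pochrN_eq0 n k : (n < k)%N -> pochr (- n%:R) k = 0.
Proof.
by move=> nk; rewrite /pochr (bigD1 (Ordinal nk)) //= addNr mul0r.
Qed.

Lemma pochrN_neq0 n : pochr (- n%:R) n != 0.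
Proof.
apply/prodf_neq0 => i _; rewrite addrC subr_eq0 eqr_nat.
by rewrite neq_ltn ltn_ord.
Qed.

Lemma poly_monomial_ind (P : {poly F} -> Prop) :
  P 0 -> (forall p q, P p -> P q -> P (p + q)) ->
  (forall c k, P (c *: 'X^k)) -> forall p, P p.
Proof.
by move=> P0 PD PM p; rewrite -(coefK p) poly_def; apply: big_ind.
Qed.

(** The prefactor [pochr (a + 1) n / n!] is the Gamma quotient of the Szego normalisation, made
    rational so that it makes sense in any ordered field. *)
Definition jcoef a b n k : F :=
  pochr (a + 1) n / n`!%:R *
  (pochr (- n%:R) k * pochr (n%:R + a + b + 1) k / (pochr (a + 1) k * k`!%:R)).

Definition jac a b n : {poly F} := \poly_(k < n.+1) jcoef a b n k.

Lemma coef_jac a b n k : (jac a b n)`_k = jcoef a b n k.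
Proof.
rewrite coef_poly ltnS; case: leqP => // nk.
by rewrite /jcoef pochrN_eq0 // !mul0r mulr0.
Qed.

Lemma natr_neq0 n : (n.+1%:R : F) != 0.
Proof. by rewrite pnatr_eq0. Qed.

Lemma fact_neq0 n : (n`!%:R : F) != 0.
Proof. by rewrite pnatr_eq0 -lt0n fact_gt0. Qed.

Lemma addr1_natr_neq0 a k : -1 < a -> a + 1 + k%:R != 0.
Proof. by move=> a1; have := ler0n F k; lra. Qed.

Lemma jcoefS a b n k : -1 < a ->
  (k%:R + 1) * (a + 1 + k%:R) * jcoef a b n k.+1 =
  (k%:R - n%:R) * (n%:R + a + b + 1 + k%:R) * jcoef a b n k.
Proof.
move=> a1; rewrite /jcoef !pochrS factS natrM -natr1.
have h1 := addr1_natr_neq0 k a1; have h2 := natr_neq0 k; have h3 := fact_neq0 n.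
have h4 := fact_neq0 k; have h5 : pochr (a + 1) k != 0 by rewrite pochr_neq0 //; lra.
by rewrite -natr1 in h2; field; rewrite h1 h2 h3 h4 h5.
Qed.

(** The Gauss hypergeometric operator with parameters [-n], [n + a + b + 1] and [a + 1], without its
    zeroth-order term, which becomes the eigenvalue. *)
Definition jop a b p : {poly F} :=
  'X * (1 - 'X) * p^`()^`() + ((a + 1)%:P - (a + b + 2) *: 'X) * p^`().

Lemma coef_jop a b p k :
  (jop a b p)`_k = (k%:R + 1) * (a + 1 + k%:R) * p`_k.+1
                   - k%:R * (k%:R + a + b + 1) * p`_k.
Proof.
rewrite /jop.
have -> : 'X * (1 - 'X) * p^`()^`() + ((a + 1)%:P - (a + b + 2) *: 'X) * p^`()
  = p^`()^`() * 'X - p^`()^`() * 'X * 'X + (a + 1) *: p^`()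
    - (a + b + 2) *: (p^`() * 'X) by rewrite -!mul_polyC; ring.
rewrite !coefB !coefD !coefZ !coefN !coefMX.
by case: k => [|[|k]] /=; rewrite ?coefMX ?coef_deriv /=; ring.
Qed.

Lemma jac_ode a b n : -1 < a ->
  jop a b (jac a b n) = (- (n%:R * (n%:R + a + b + 1))) *: jac a b n.
Proof.
move=> a1; apply/polyP => k; rewrite coef_jop coefZ !coef_jac jcoefS //; ring.
Qed.

(* [a + 1 + k] never vanishes, so the equation determines all coefficients
   from the constant one. *)
Lemma jop_eigen_unique a b c p q : -1 < a ->
  jop a b p = c *: p -> jop a b q = c *: q -> q`_0 *: p = p`_0 *: q.
Proof.
move=> a1 Hp Hq; apply/polyP => k; rewrite !coefZ.
elim: k => [|k IH]; first by rewrite mulrC.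
have Hk r : jop a b r = c *: r ->
    r`_k.+1 = (c + k%:R * (k%:R + a + b + 1)) / ((k%:R + 1) * (a + 1 + k%:R)) * r`_k.
  move=> /(congr1 (fun s : {poly F} => s`_k)); rewrite coef_jop coefZ => E.
  have h1 := addr1_natr_neq0 k a1; have := natr_neq0 k; rewrite -natr1 => h2.
  have H : (k%:R + 1) * (a + 1 + k%:R) * r`_k.+1 = (c + k%:R * (k%:R + a + b + 1)) * r`_k.
    by rewrite [RHS]mulrDl -E; ring.
  by apply: (mulfI (mulf_neq0 h2 h1)); rewrite H; field; rewrite h1 h2.
by rewrite (Hk p Hp) (Hk q Hq) mulrCA IH mulrCA.
Qed.

Definition refl_poly : {poly F} := 1 - 'X.

Lemma deriv_comp_refl p : (p \Po refl_poly)^`() = - (p^`() \Po refl_poly).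
Proof. by rewrite deriv_comp /refl_poly derivB derivX derivC sub0r mulrN1. Qed.

Lemma jop_comp_refl a b p : jop a b (p \Po refl_poly) = jop b a p \Po refl_poly.
Proof.
rewrite /jop !deriv_comp_refl derivN deriv_comp_refl opprK.
rewrite comp_polyD !comp_polyM !comp_polyB comp_polyX comp_polyC comp_polyZ comp_polyX.
rewrite -[1]/(1%:P) comp_polyC /refl_poly -!mul_polyC; ring.
Qed.

Lemma jac_shift_gt0 a b n : -1 < a -> -1 < b -> 0 < n.+1%:R + a + b + 1.
Proof. by move=> a1 b1; rewrite -natr1; have := ler0n F n; lra. Qed.

Lemma jcoef_lead a b n : -1 < a ->
  jcoef a b n n = pochr (- n%:R) n * pochr (n%:R + a + b + 1) n / (n`!%:R * n`!%:R).
Proof.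
move=> a1; have h : pochr (a + 1) n != 0 by rewrite pochr_neq0 //; lra.
by rewrite /jcoef; have h' := fact_neq0 n; field; rewrite h h'.
Qed.

Lemma jcoef_lead_neq0 a b n : -1 < a -> -1 < b -> jcoef a b n n != 0.
Proof.
move=> a1 b1; rewrite jcoef_lead // mulf_neq0 ?invr_eq0 ?mulf_neq0 ?fact_neq0 ?pochrN_neq0 //.
by case: n => [|n]; rewrite ?pochr0 ?oner_neq0 // pochr_neq0 // jac_shift_gt0.
Qed.

Lemma size_jac a b n : -1 < a -> -1 < b -> size (jac a b n) = n.+1.
Proof. by move=> a1 b1; rewrite size_poly_eq // jcoef_lead_neq0. Qed.

Lemma lead_coef_jac a b n : -1 < a -> -1 < b -> lead_coef (jac a b n) = jcoef a b n n.
Proof. by move=> a1 b1; rewrite lead_coefE size_jac // coef_jac. Qed.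

Lemma size_refl_poly : size refl_poly = 2%N.
Proof. by rewrite /refl_poly -opprB size_polyN size_XsubC. Qed.

Lemma lead_coef_refl_poly : lead_coef refl_poly = -1.
Proof. by rewrite /refl_poly -opprB lead_coefN lead_coefXsubC. Qed.

(** Reflection exchanges [a] and [b] in the operator, and the eigenvalue is symmetric in them, so
    the reflected polynomial is a multiple of [jac a b n]. The leading coefficient is symmetric too,
    which leaves only the sign [(-1)^n] of the substitution. *)
Lemma jac_refl a b n : -1 < a -> -1 < b ->
  jac b a n \Po refl_poly = (-1) ^+ n *: jac a b n.
Proof.
move=> a1 b1; set q := _ \Po _.
have Hq : jop a b q = (- (n%:R * (n%:R + a + b + 1))) *: q.
  by rewrite jop_comp_refl jac_ode // comp_polyZ [_ + b + a]addrAC.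
have E := jop_eigen_unique a1 (jac_ode b n a1) Hq.
have lq : lead_coef q = (-1) ^+ n * jcoef a b n n.
  rewrite lead_coef_comp ?size_refl_poly // lead_coef_refl_poly lead_coef_jac // size_jac //.
  by rewrite mulrC !jcoef_lead // [_ + b + a]addrAC.
have nz := jcoef_lead_neq0 n a1 b1.
have j0 : (jac a b n)`_0 != 0.
  have p0 : pochr (a + 1) n != 0 by rewrite pochr_neq0 //; lra.
  by rewrite coef_jac /jcoef !pochr0 fact0 !mulr1 invr1 !mulr1 mulf_neq0 ?invr_eq0 ?fact_neq0.
have Eq : q = (q`_0 / (jac a b n)`_0) *: jac a b n.
  by rewrite mulrC -scalerA E scalerA mulVf // scale1r.
have /(mulIf nz) -> // : (-1) ^+ n * jcoef a b n n = q`_0 / (jac a b n)`_0 * jcoef a b n n.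
by rewrite -lq {1}Eq lead_coefZ lead_coef_jac.
Qed.

Lemma horner_jac_refl a b n x : -1 < a -> -1 < b ->
  (jac b a n).[1 - x] = (-1) ^+ n * (jac a b n).[x].
Proof.
move=> a1 b1; rewrite -hornerZ -jac_refl // horner_comp /refl_poly.
by rewrite hornerD hornerN hornerX hornerC.
Qed.

Lemma deriv_jac a b n : -1 < a ->
  (jac a b n.+1)^`() = (- (n.+1%:R + a + b + 1)) *: jac (a + 1) (b + 1) n.
Proof.
move=> a1; apply/polyP => k; rewrite coef_deriv coefZ !coef_jac /jcoef -mulr_natr.
rewrite (pochrSl (a + 1) n) (pochrSl _ k) (pochrSl (n.+1%:R + a + b + 1)) (pochrSl (a + 1) k).
have -> : - n.+1%:R + 1 = - n%:R :> F by rewrite -natr1; ring.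
have -> : n%:R + (a + 1) + (b + 1) + 1 = n.+1%:R + a + b + 1 + 1 :> F by rewrite -natr1; ring.
rewrite !factS !natrM.
have h1 := natr_neq0 n; have h2 := natr_neq0 k; have h3 := fact_neq0 n; have h4 := fact_neq0 k.
have h5 : pochr (a + 1 + 1) k != 0 by rewrite pochr_neq0 //; lra.
have h6 : a + 1 != 0 by lra.
by rewrite -natr1 in h1 *; rewrite -natr1 in h2 *; field; rewrite h1 h2 h3 h4 h5 h6.
Qed.

(** For [x <= 0] the signs of [(-n)_k] and [x^k] cancel, so all terms of the series are nonnegative
    and the constant one is positive. *)
Lemma jac_horner_neq0 a b n x : -1 < a -> -1 < b -> 0 < n%:R + a + b + 1 -> x <= 0 ->
  (jac a b n).[x] != 0.
Proof.
move=> a1 b1 s0 x0; rewrite gt_eqF // horner_poly big_ord_recl.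
have A0 : 0 < pochr (a + 1) n / n`!%:R :> F.
  by rewrite divr_gt0 ?ltr0n ?fact_gt0 ?pochr_gt0 //; lra.
rewrite ltr_pwDl //.
  by rewrite /jcoef /= !pochr0 fact0 expr0 !mulr1 invr1 !mulr1.
apply: sumr_ge0 => i _; rewrite /jcoef; set k := lift _ _.
have E (r u v t : F) : r * (u * v / t) * x ^+ k = r * ((u * x ^+ k) * v / t) by ring.
rewrite E; apply: mulr_ge0; first exact: ltW.
apply: divr_ge0; last by apply: mulr_ge0; rewrite ?ler0n // ltW // pochr_gt0 //; lra.
apply: mulr_ge0; last by rewrite ltW // pochr_gt0.
have -> : x ^+ k = \prod_(j < k) x by rewrite prodr_const card_ord.
rewrite /pochr -big_split /=; apply: prodr_ge0 => j _; rewrite mulr_le0 //.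
rewrite addrC subr_le0 ler_nat; apply: ltnW.
exact: leq_trans (ltn_ord j) (ltn_ord k).
Qed.

(** The derivative is again a Jacobi polynomial, and reflection moves [x >= 1] to [1 - x <= 0]. In
    the original variable this excludes critical points at or to the left of -1. *)
Lemma deriv_jac_horner_neq0 a b n x : -1 < a -> -1 < b -> (0 < n)%N -> 1 <= x ->
  (jac a b n)^`().[x] != 0.
Proof.
case: n => // n a1 b1 _ x1; rewrite deriv_jac // hornerZ.
have a2 : -1 < a + 1 by lra.
have b2 : -1 < b + 1 by lra.
apply: mulf_neq0; first by rewrite oppr_eq0 gt_eqF // jac_shift_gt0.
have := @horner_jac_refl _ _ n (1 - x) b2 a2; rewrite subKr => ->.
by rewrite mulf_neq0 ?signr_eq0 // jac_horner_neq0 //; have := ler0n F n; lra.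
Qed.

(** * The moment functional *)

Section Moments.
Variables a b : F.

(* Moments of the Jacobi weight in [z], normalised so that [jmean 1 = 1]. *)
Definition jmoment k : F := pochr (a + 1) k / pochr (a + b + 2) k.

Definition jmean p : F := \sum_(k < size p) p`_k * jmoment k.

Lemma jmeanE m p : (size p <= m)%N -> jmean p = \sum_(k < m) p`_k * jmoment k.
Proof.
move=> pm; rewrite /jmean -!(big_mkord xpredT (fun k => p`_k * jmoment k)).
rewrite [RHS](big_cat_nat (leq0n _) pm) /= [X in _ = _ + X]big_nat_cond.
rewrite [X in _ = _ + X]big1 ?addr0 // => k /andP[/andP[pk _] _].
by rewrite nth_default // mul0r.
Qed.

Lemma jmean_is_scalar : scalar jmean.
Proof.
move=> c p q; set m := maxn (size p) (size q).
have hp : (size p <= m)%N by rewrite leq_maxl.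
have hq : (size q <= m)%N by rewrite leq_maxr.
have hr : (size (c *: p + q)%R <= m)%N.
  by rewrite (leq_trans (size_polyD _ _)) // geq_max hq (leq_trans (size_scale_leq _ _)).
rewrite (jmeanE hr) (jmeanE hp) (jmeanE hq) mulr_sumr -big_split /=.
by apply: eq_bigr => k _; rewrite coefD coefZ mulrDl mulrA.
Qed.

HB.instance Definition _ := GRing.isLinear.Build F {poly F} F *%R jmean jmean_is_scalar.

Lemma jmeanXn k : jmean 'X^k = jmoment k.
Proof.
rewrite (@jmeanE k.+1) ?size_polyXn // big_ord_recr /= big1 => [|i _].
  by rewrite add0r coefXn eqxx mul1r.
by rewrite coefXn ltn_eqF ?mul0r // ltn_ord.
Qed.

Lemma jmean1 : jmean 1 = 1.
Proof. by rewrite -(expr0 'X) jmeanXn /jmoment !pochr0 divr1. Qed.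

Hypotheses (a1 : -1 < a) (b1 : -1 < b).

Lemma jmomentS k : (a + b + 2 + k%:R) * jmoment k.+1 = (a + 1 + k%:R) * jmoment k.
Proof.
have h : 0 < a + b + 2 by move: a1 b1; lra.
have h1 := pochr_neq0 k h.
have h2 : a + b + 2 + k%:R != 0 by move: a1 b1 (ler0n F k); lra.
by rewrite /jmoment !pochrS; field; rewrite h1 h2.
Qed.

(* Integration by parts against the weight: the boundary terms vanish. *)
Lemma jmean_pearson p :
  jmean ('X * (1 - 'X) * p^`() + ((a + 1)%:P - (a + b + 2) *: 'X) * p) = 0.
Proof.
elim/poly_monomial_ind: p => [|p q IHp IHq|c k].
- by rewrite derivC !mulr0 addr0 linear0.
- have E (u v r s : {poly F}) : u * (r + s) + v * (p + q) = (u * r + v * p) + (u * s + v * q).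
    by ring.
  by rewrite derivD E linearD /= IHp IHq addr0.
have -> : 'X * (1 - 'X) * (c *: 'X^k)^`() + ((a + 1)%:P - (a + b + 2) *: 'X) * (c *: 'X^k)
  = c *: ((a + 1 + k%:R) *: 'X^k - (a + b + 2 + k%:R) *: 'X^(k.+1)).
  rewrite derivZ derivXn.
  have -> : 'X * (1 - 'X) * (c *: ('X^(k.-1) *+ k)) = c *: (k%:R *: ('X^k - 'X^(k.+1))) :> {poly F}.
    case: k => [|k]; first by rewrite mulr0n scaler0 mulr0 scale0r scaler0.
    by rewrite /= !exprS -mulr_natr -polyC_natr -!mul_polyC; ring.
  by rewrite -!mul_polyC exprS !rmorphD /=; ring.
by rewrite linearZ /= linearB /= !linearZ /= !jmeanXn jmomentS subrr mulr0.
Qed.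

(** [jmean_pearson] at the product [p' q]. The right side is symmetric in [p] and [q], so the
    operator is self-adjoint for the moment functional. *)
Lemma jmean_jop p q : jmean (q * jop a b p) = - jmean ('X * (1 - 'X) * (p^`() * q^`())).
Proof.
apply/eqP; rewrite -addr_eq0 -linearD /=; apply/eqP.
rewrite -[RHS](jmean_pearson (p^`() * q)) derivM /jop; congr jmean.
by rewrite -!mul_polyC; ring.
Qed.

Lemma jmean_jac_deriv n q :
  jmean ('X * (1 - 'X) * ((jac a b n)^`() * q^`())) =
  n%:R * (n%:R + a + b + 1) * jmean (jac a b n * q).
Proof.
apply: oppr_inj; rewrite -jmean_jop jac_ode // -scalerAr linearZ /= mulNr.
by rewrite [q * _]mulrC.
Qed.

Lemma jac_orthogonal n m : n != m -> jmean (jac a b n * jac a b m) = 0.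
Proof.
move=> nm.
have := jmean_jac_deriv m (jac a b n).
rewrite [_^`() * _]mulrC jmean_jac_deriv [jac a b m * _]mulrC => /eqP.
rewrite -subr_eq0 -mulrBl mulf_eq0 => /orP[|/eqP //].
(* The two eigenvalues differ even when [a + b + 1 < 0]: distinct [n] and [m] have [n + m >= 1], and
   [a + b > -2], so the second factor is positive. *)
have -> : n%:R * (n%:R + a + b + 1) - m%:R * (m%:R + a + b + 1)
   = (n%:R - m%:R) * (n%:R + m%:R + a + b + 1) :> F by ring.
rewrite mulf_eq0 subr_eq0 eqr_nat (negbTE nm) /= => /eqP h; exfalso.
have : (1 : F) <= n%:R + m%:R by rewrite -natrD ler1n addn_gt0; case: n m nm {h} => [|n] [|m].
by move: a1 b1; lra.
Qed.

Definition jnorm n : F := jmean (jac a b n ^+ 2).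

End Moments.

(** [B(a + 2, b + 2) / B(a + 1, b + 1)], the mean of [z (1 - z)]. *)
Definition shift_ratio a b : F := (a + 1) * (b + 1) / ((a + b + 2) * (a + b + 3)).

Lemma jmean_shift a b p : -1 < a -> -1 < b ->
  jmean a b ('X * (1 - 'X) * p) = shift_ratio a b * jmean (a + 1) (b + 1) p.
Proof.
move=> a1 b1; elim/poly_monomial_ind: p => [|p q IHp IHq|c k].
- by rewrite mulr0 !linear0 mulr0.
- by rewrite mulrDr !linearD /= IHp IHq mulrDr.
have -> : 'X * (1 - 'X) * (c *: 'X^k) = c *: ('X^(k.+1) - 'X^(k.+2)) :> {poly F}.
  by rewrite !exprS -!mul_polyC; ring.
rewrite !linearZ /= linearB /= !jmeanXn mulrCA; congr (_ * _).
rewrite /jmoment /shift_ratio !(pochrS _ k.+1) (pochrSl (a + 1)) (pochrSl (a + b + 2)).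
have -> : a + b + 2 + k.+1%:R = a + b + 3 + k%:R :> F by rewrite -natr1; ring.
have -> : a + 1 + (b + 1) + 2 = a + b + 3 + 1 :> F by ring.
have h0 : 0 < a + b + 3 by lra.
have h1 : 0 < a + b + 3 + 1 by lra.
have E := pochrSl (a + b + 3) k; rewrite pochrS in E.
have h2 := pochr_neq0 k h0; have h3 := pochr_neq0 k h1.
have h4 : a + b + 3 + k%:R != 0 by have := ler0n F k; lra.
have -> : a + b + 2 + 1 = a + b + 3 :> F by ring.
have -> : pochr (a + b + 3 + 1) k = pochr (a + b + 3) k * (a + b + 3 + k%:R) / (a + b + 3).
  by rewrite E mulrC mulKf // gt_eqF.
have h5 : a + b + 2 != 0 by lra.
have h6 : a + b + 3 != 0 by lra.
by rewrite -natr1; field; rewrite h2 h4 h5 h6.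
Qed.

(** The mean of [z (1 - z) P'^2] is computed twice: by the eigenvalue it is a multiple of the norm
    of [P], and by [deriv_jac] a multiple of a norm for the weight with both parameters raised. *)
Lemma jnormS a b n : -1 < a -> -1 < b ->
  jnorm a b n.+1 =
  (n.+1%:R + a + b + 1) / n.+1%:R * shift_ratio a b * jnorm (a + 1) (b + 1) n.
Proof.
move=> a1 b1; have := jmean_jac_deriv a1 b1 n.+1 (jac a b n.+1).
have Z (c : F) (u r : {poly F}) : u * ((c *: r) * (c *: r)) = c ^+ 2 *: (u * r ^+ 2).
  by rewrite -!mul_polyC rmorphXn /=; ring.
rewrite deriv_jac // Z linearZ /= jmean_shift // -expr2.
rewrite -/(jnorm _ _ _) -/(jnorm _ _ _).
set s := _ + 1 => E; have s0 : s != 0 by rewrite gt_eqF // jac_shift_gt0.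
have n0 := natr_neq0 n.
by apply: (mulfI (mulf_neq0 n0 s0)); rewrite -E; field; rewrite addrC natr1.
Qed.

Lemma jnorm0 a b : jnorm a b 0 = 1.
Proof.
rewrite /jnorm; have -> : jac a b 0 = 1.
  apply/polyP => k; rewrite coef_jac coef1 /jcoef fact0 !pochr0; case: k => [|k].
    by rewrite !pochr0 fact0 !mulr1 !invr1 !mulr1.
  by rewrite pochrN_eq0 // !mul0r mulr0.
by rewrite expr1n jmean1.
Qed.

Lemma jnorm_gt0 a b n : -1 < a -> -1 < b -> 0 < jnorm a b n.
Proof.
elim: n a b => [|n IH] a b a1 b1; first by rewrite jnorm0.
rewrite jnormS // !mulr_gt0 ?invr_gt0 ?ltr0n ?jac_shift_gt0 ?mulr_gt0 ?IH //; try lra.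
Qed.

(** * Expansions and the Gauss-Lobatto quadrature *)

Lemma graded_expansion (f : nat -> {poly F}) n p :
  (forall k, size (f k) = k.+1) -> (size p <= n)%N ->
  exists c : nat -> F, p = \sum_(k < n) c k *: f k.
Proof.
move=> fs; elim: n p => [|n IH] p.
  by rewrite leqn0 size_poly_eq0 => /eqP->; exists (fun=> 0); rewrite big_ord0.
move=> pn; have fn : (f n)`_n != 0.
  by have := lead_coef_eq0 (f n); rewrite lead_coefE fs /= -size_poly_eq0 fs => ->.
pose d := p`_n / (f n)`_n.
have [|c E] := IH (p - d *: f n).
  apply/leq_sizeP => j nj; rewrite coefB coefZ.
  move: nj; rewrite leq_eqVlt => /orP[/eqP<-|nj]; first by rewrite divfK // subrr.
  by rewrite !nth_default ?mulr0 ?subr0 ?fs // (leq_trans pn).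
exists (fun k => if k == n then d else c k); rewrite big_ord_recr /= eqxx.
rewrite (eq_bigr (fun k : 'I_n => c k *: f k)) => [|k _]; first by rewrite -E subrK.
by rewrite ltn_eqF.
Qed.

Lemma jac_expansion a b n p : -1 < a -> -1 < b -> (size p <= n)%N ->
  exists c : nat -> F, p = \sum_(k < n) c k *: jac a b k.
Proof. by move=> a1 b1; apply: graded_expansion => k; rewrite size_jac. Qed.

Lemma jac_independent a b n (c d : nat -> F) : -1 < a -> -1 < b ->
  \sum_(k < n) c k *: jac a b k = \sum_(k < n) d k *: jac a b k ->
  forall k, (k < n)%N -> c k = d k.
Proof.
move=> a1 b1 E k kn.
have H (e : nat -> F) : jmean a b ((\sum_(i < n) e i *: jac a b i) * jac a b k)
    = e k * jnorm a b k.
  rewrite mulr_suml linear_sum (bigD1 (Ordinal kn)) //= big1 => [|i ik].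
    by rewrite -scalerAl linearZ addr0.
  by rewrite -scalerAl linearZ /= jac_orthogonal ?mulr0.
by apply: (mulIf (lt0r_neq0 (jnorm_gt0 k a1 b1))); rewrite -!H E.
Qed.

Section Quadrature.
Variables (a b M : F) (N : nat) (z w : nat -> F).
Hypotheses (a1 : -1 < a) (b1 : -1 < b) (N0 : (0 < N)%N) (M0 : M != 0).

Definition quad p : F := \sum_(j < N.+1) p.[z j] * w j.

Lemma quad_is_scalar : scalar quad.
Proof.
move=> c p q; rewrite /quad mulr_sumr -big_split /=; apply: eq_bigr => j _.
by rewrite hornerD hornerZ mulrDl mulrA.
Qed.

HB.instance Definition _ := GRing.isLinear.Build F {poly F} F *%R quad quad_is_scalar.

Hypothesis quad_exact : forall p, (size p <= 2 * N)%N -> quad p = M * jmean a b p.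
Hypothesis nodes : forall j, (j <= N)%N -> ('X * (1 - 'X) * (jac a b N)^`()).[z j] = 0.

Definition jnormt n : F := if n == N then (2 + (a + b + 1) / N%:R) * jnorm a b n else jnorm a b n.

Lemma jnormt_gt0 n : 0 < jnormt n.
Proof.
rewrite /jnormt; case: eqP => _; last exact: jnorm_gt0.
rewrite mulr_gt0 ?jnorm_gt0 //.
have N1 : (1 : F) <= N%:R by rewrite ler1n.
have Np : (0 : F) < N%:R by lra.
have -> : 2 + (a + b + 1) / N%:R = (2 * N%:R + (a + b + 1)) / N%:R.
  by field; rewrite gt_eqF.
by rewrite divr_gt0 //; move: a1 b1; lra.
Qed.

(* [N^2 P^2 + z (1 - z) P'^2] has degree below [2 N], and its second term
   vanishes at the nodes. *)
Lemma quad_jac_top : quad (jac a b N ^+ 2) = M * jnormt N.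
Proof.
rewrite /jnormt eqxx; set P := jac a b N.
pose r := (N%:R ^+ 2) *: P ^+ 2 + 'X * (1 - 'X) * (P^`() * P^`()).
have Nn0 : (N%:R : F) != 0 by rewrite pnatr_eq0 -lt0n.
have sr : (size r <= 2 * N)%N.
  have sP : size P = N.+1 by rewrite size_jac.
  (* [N^2 P^2 - z^2 P'^2] is factored as a difference of squares: [N P] and [z P'] have the same
     leading term, so one factor loses a degree. *)
  have -> : r = (N%:R *: P - 'X * P^`()) * (N%:R *: P + 'X * P^`()) + 'X * P^`() * P^`().
    by rewrite /r -!mul_polyC rmorphXn /=; ring.
  have sX : (size ('X * P^`())%R <= N.+1)%N.
    rewrite mulrC (leq_trans (size_polyMleq _ _)) // size_polyX addn2 /= ltnS.
    by rewrite -ltnS -sP lt_size_deriv // -size_poly_eq0 sP.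
  have sD : (size P^`() <= N)%N.
    by rewrite -ltnS -sP lt_size_deriv // -size_poly_eq0 sP.
  have s1 : (size (N%:R *: P - 'X * P^`())%R <= N)%N.
    apply/leq_sizeP => j; rewrite leq_eqVlt => /orP[/eqP<-|Nj].
      rewrite coefB coefZ ['X * _]mulrC coefMX eqn0Ngt N0 /=.
      by rewrite coef_deriv prednK // mulr_natl subrr.
    rewrite nth_default // (leq_trans _ Nj) // (leq_trans (size_polyD _ _)) // size_polyN geq_max sX.
    by rewrite (leq_trans (size_scale_leq _ _)) // sP.
  have s2 : (size (N%:R *: P + 'X * P^`())%R <= N.+1)%N.
    rewrite (leq_trans (size_polyD _ _)) // geq_max sX andbT.
    by rewrite (leq_trans (size_scale_leq _ _)) // sP.
  rewrite (leq_trans (size_polyD _ _)) // geq_max; apply/andP; split.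
    rewrite (leq_trans (size_polyMleq _ _)) // mul2n -addnn.
    by rewrite -subn1 leq_subLR (leq_trans (leq_add s1 s2)) // addnS add1n.
  rewrite (leq_trans (size_polyMleq _ _)) // mul2n -addnn.
  by rewrite -subn1 leq_subLR (leq_trans (leq_add sX sD)).
have Qr : quad r = N%:R ^+ 2 * quad (P ^+ 2).
  rewrite /r linearD linearZ /= [X in _ + X](_ : _ = 0) ?addr0 //.
  rewrite /quad big1 // => j _; rewrite mulrA hornerM nodes ?mul0r //.
  by rewrite -ltnS ltn_ord.
(* Divided by [N^2], the factor in front of the norm is [2 + (a + b + 1) / N], the correction made
   in [jnormt]. *)
have Er : jmean a b r = (N%:R ^+ 2 + N%:R * (N%:R + a + b + 1)) * jnorm a b N.
  by rewrite /r linearD linearZ /= jmean_jac_deriv // -expr2 -mulrDl.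
apply: (mulfI (expf_neq0 2 Nn0)); rewrite -Qr quad_exact // Er.
by field.
Qed.

Lemma quad_jac n m : (n <= N)%N -> (m <= N)%N ->
  quad (jac a b n * jac a b m) = if n == m then M * jnormt n else 0.
Proof.
move=> nN mN; have [/andP[/eqP-> /eqP->]|top] := boolP ((n == N) && (m == N)).
  by rewrite eqxx quad_jac_top.
rewrite quad_exact; last first.
  rewrite (leq_trans (size_polyMleq _ _)) // !size_jac // addSn addnS /= mul2n -addnn.
  move: nN mN top; rewrite leq_eqVlt => /orP[/eqP->|nN] mN.
    rewrite eqxx /= => mN'; rewrite -addnS leq_add2l.
    by rewrite ltn_neqAle mN' mN.
  by move=> _; rewrite -addSn leq_add.
case: eqP => [nm|/eqP nm]; last by rewrite jac_orthogonal ?mulr0.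
move: top; rewrite -nm andbb => /negbTE nN'.
by rewrite /jnormt nN' /jnorm expr2.
Qed.

Lemma quad_expansion p : (size p <= N.+1)%N ->
  p = \sum_(n < N.+1) (quad (p * jac a b n) / (M * jnormt n)) *: jac a b n.
Proof.
move=> /(jac_expansion a1 b1)[c E]; rewrite {1}E; apply: eq_bigr => n _.
have nz : M * jnormt n != 0 by rewrite mulf_neq0 // gt_eqF // jnormt_gt0.
have H (i : 'I_N.+1) : quad (c i *: jac a b i * jac a b n) = c i * (if i == n then M * jnormt n else 0).
  rewrite -scalerAl linearZ /= (quad_jac (ltn_ord i) (ltn_ord n)) -val_eqE /=.
  by case: eqP => // ->.
congr (_ *: _); apply: (mulIf nz); rewrite divfK // E [X in quad X]mulr_suml linear_sum /=.
rewrite (bigD1 n) //= H eqxx big1 ?addr0 // => i ni.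
by rewrite H (negbTE ni) mulr0.
Qed.

(** With [p] the Lagrange polynomial and [q] the Jacobi polynomial of degree [n], this is the
    numerator of [t_nj]. *)
Lemma quad_delta p q j : (j <= N)%N ->
  (forall i, (i <= N)%N -> p.[z i] = (i == j)%:R) ->
  quad (p * q) = q.[z j] * w j.
Proof.
move=> jN pz; rewrite /quad (bigD1 (Ordinal (jN : (j < N.+1)%N))) //= big1 => [|i ij].
  by rewrite addr0 hornerM pz // eqxx mul1r.
have ij' : (nat_of_ord i == j) = false by apply/negbTE; rewrite -val_eqE in ij.
by rewrite hornerM pz ?ij' ?mul0r // -ltnS.
Qed.

End Quadrature.
End Jacobi.
End JacobiPoly.

(** * Moments and norms for the Jacobi weight *)

Lemma Gamma_poch (p : R) (n : nat) : 0 < p -> Gamma (p + INR n) = poch p n * Gamma p.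
Proof.
intros p0; unfold poch; induction n as [|n IH]; simpl prodR.
- simpl; rewrite Rplus_0_r; ring.
- rewrite S_INR, <- Rplus_assoc, Gamma_succ, IH by (pose proof (pos_INR n); lra); ring.
Qed.

Lemma poch_pos (p : R) (n : nat) : 0 < p -> 0 < poch p n.
Proof.
intros p0; unfold poch; induction n as [|n IH]; simpl; [lra|].
pose proof (pos_INR n); nra.
Qed.

Lemma beta_integrand_moment (a b y : R) (k : nat) :
  -1 < y < 1 ->
  ((1 - y) / 2) ^ k * (Rpower (1 - y) a * Rpower (1 + y) b) =
  Rpower 2 (a + b) * beta_integrand (a + 1 + INR k) (b + 1) y.
Proof.
intros Hy; unfold beta_integrand.
replace (a + 1 + INR k - 1) with (a + INR k) by ring; replace (b + 1 - 1) with b by ring.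
rewrite !Rpower_plus, Rpower_pow by lra.
replace (1 - y) with (2 * ((1 - y) / 2)) at 2 by field.
replace (1 + y) with (2 * ((1 + y) / 2)) at 1 by field.
rewrite <- !Rpower_mult_distr by lra; ring.
Qed.

(** The integral of the weight, [2^(a+b+1) B(a + 1, b + 1)]. *)
Definition jacobi_mass (a b : R) : R :=
  Rpower 2 (a + b + 1) * Gamma (a + 1) * Gamma (b + 1) / Gamma (a + b + 2).

Lemma jacobi_mass_pos (a b : R) : -1 < a -> -1 < b -> 0 < jacobi_mass a b.
Proof.
intros a1 b1; unfold jacobi_mass.
apply Rdiv_lt_0_compat; repeat apply Rmult_lt_0_compat; try apply Rpower_pos;
  apply Gamma_pos; lra.
Qed.

Lemma jacobi_weight_moment (a b : R) (k : nat) :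
  -1 < a -> -1 < b ->
  is_RInt_gen (fun y => ((1 - y) / 2) ^ k * (Rpower (1 - y) a * Rpower (1 + y) b))
    (at_right (-1)) (at_left 1)
    (jacobi_mass a b * (poch (a + 1) k / poch (a + b + 2) k)).
Proof.
intros a1 b1; pose proof (pos_INR k).
assert (p0 : 0 < a + 1 + INR k) by lra. assert (q0 : 0 < b + 1) by lra.
assert (s0 : 0 < a + b + 2) by lra.
pose proof (beta_Gamma _ _ p0 q0) as E.
replace (a + 1 + INR k + (b + 1)) with (a + b + 2 + INR k) in E by ring.
rewrite !Gamma_poch in E by lra.
pose proof (Gamma_pos _ s0); pose proof (poch_pos _ k s0).
replace (jacobi_mass a b * _) with
  (Rpower 2 (a + b) * beta_integral (a + 1 + INR k) (b + 1)).
2:{ unfold jacobi_mass; rewrite (Rpower_succ 2) by lra.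
    apply Rmult_eq_reg_r with (poch (a + b + 2) k * Gamma (a + b + 2)); [|nra].
    rewrite Rmult_assoc, E; field; lra. }
refine (improper_ext _ _ _ unit_ends _ _ _ _
  (improper_scal _ _ _ _ _ (beta_integral_correct _ _ p0 q0))).
intros y Hy; simpl; now rewrite beta_integrand_moment.
Qed.

Lemma jacobi_mass_shift (a b : R) :
  -1 < a -> -1 < b ->
  jacobi_mass (a + 1) (b + 1) =
  4 * ((a + 1) * (b + 1) / ((a + b + 2) * (a + b + 3))) * jacobi_mass a b.
Proof.
intros a1 b1; unfold jacobi_mass.
replace (a + 1 + (b + 1) + 1) with (a + b + 1 + 1 + 1) by ring.
replace (a + 1 + (b + 1) + 2) with (a + b + 2 + 1 + 1) by ring.
rewrite (Gamma_succ (a + 1)), (Gamma_succ (b + 1)), (Gamma_succ (a + b + 2 + 1)),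
  (Gamma_succ (a + b + 2)), !(Rpower_succ 2) by lra.
assert (s0 : 0 < a + b + 2) by lra; pose proof (Gamma_pos _ s0); field; lra.
Qed.

Lemma gamma_n_S (a b : R) (n : nat) :
  -1 < a -> -1 < b ->
  gamma_n a b (S n) =
  (INR (S n) + a + b + 1) / (4 * INR (S n)) * gamma_n (a + 1) (b + 1) n.
Proof.
intros a1 b1; pose proof (pos_INR n).
(* After the shift [a + b + 3] is positive, so the separate clause of [gamma_n] at 0 agrees with the
   general formula. *)
assert (E : gamma_n (a + 1) (b + 1) n =
  Rpower 2 (a + b + 1) * 4 * Gamma (INR n + a + 2) * Gamma (INR n + b + 2)
  / ((2 * INR n + a + b + 3) * INR (fact n) * Gamma (INR n + a + b + 3))).
{ replace (Rpower 2 (a + b + 1) * 4) with (Rpower 2 (a + 1 + (b + 1) + 1)).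
  2:{ replace (a + 1 + (b + 1) + 1) with (a + b + 1 + 1 + 1) by ring.
      rewrite !(Rpower_succ 2) by lra; ring. }
  destruct n as [|n].
  - simpl; replace (a + 1 + (b + 1) + 2) with (a + b + 3 + 1) by ring.
    replace (0 + a + 2) with (a + 1 + 1) by ring.
    replace (0 + b + 2) with (b + 1 + 1) by ring.
    replace (0 + a + b + 3) with (a + b + 3) by ring.
    assert (s0 : 0 < a + b + 3) by lra; pose proof (Gamma_pos _ s0).
    rewrite (Gamma_succ (a + b + 3)) by lra; field; lra.
  - unfold gamma_n.
    replace (INR (S n) + (a + 1) + 1) with (INR (S n) + a + 2) by ring.
    replace (INR (S n) + (b + 1) + 1) with (INR (S n) + b + 2) by ring.
    replace (INR (S n) + (a + 1) + (b + 1) + 1) with (INR (S n) + a + b + 3) by ring.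
    replace (2 * INR (S n) + (a + 1) + (b + 1) + 1) with (2 * INR (S n) + a + b + 3) by ring.
    reflexivity. }
rewrite E; unfold gamma_n; rewrite fact_simpl, mult_INR, !S_INR.
replace (INR n + 1 + a + 1) with (INR n + a + 2) by ring.
replace (INR n + 1 + b + 1) with (INR n + b + 2) by ring.
replace (INR n + 1 + a + b + 1) with (INR n + a + b + 2) by ring.
replace (INR n + a + b + 3) with (INR n + a + b + 2 + 1) by ring.
assert (s0 : 0 < INR n + a + b + 2) by lra.
rewrite (Gamma_succ (INR n + a + b + 2)) by lra.
pose proof (Gamma_pos _ s0); pose proof (INR_fact_neq_0 n); field; repeat split; lra.
Qed.

Lemma Jacobi_poch (a b x : R) (n : nat) :
  -1 < a ->
  Jacobi a b n x =
  poch (a + 1) n / INR (fact n) *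
  sum_f_R0 (fun k => poch (- INR n) k * poch (INR n + a + b + 1) k
                     / (poch (a + 1) k * INR (fact k)) * ((1 - x) / 2) ^ k) n.
Proof.
intros a1; unfold Jacobi; f_equal.
replace (INR n + a + 1) with (a + 1 + INR n) by ring.
assert (a0 : 0 < a + 1) by lra.
rewrite Gamma_poch by lra; pose proof (Gamma_pos _ a0); pose proof (INR_fact_neq_0 n).
field; lra.
Qed.

(** * Transfer to the real functions of the statement *)

Module RealJacobi.
Import all_boot all_order all_algebra ring lra Rstruct JacobiPoly.
Import Order.TTheory GRing.Theory Num.Theory.

Lemma sum_f_R0_ord (f : nat -> R) (n : nat) : sum_f_R0 f n = (\sum_(k < n.+1) f k)%R.
Proof. by rewrite sum_f_R0E big_mkord. Qed.

Lemma prodR_ord (n : nat) (f : nat -> R) : prodR n f = (\prod_(k < n) f k)%R.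
Proof. by elim: n => [|n IH] /=; rewrite ?big_ord0 // big_ord_recr IH. Qed.

Lemma pochE (a : R) (k : nat) : poch a k = pochr a k.
Proof. by rewrite /poch prodR_ord; apply: eq_bigr => i _; rewrite INRE. Qed.

Lemma ltrN1 (a : R) : -1 < a -> (-1 < a)%R.
Proof. by move=> H; apply/RltP. Qed.

Definition zvar (y : R) : R := (1 - y) / 2.

Lemma JacobiE (a b y : R) (n : nat) : -1 < a -> Jacobi a b n y = (jac a b n).[zvar y]%R.
Proof.
move=> a1; rewrite Jacobi_poch // horner_poly sum_f_R0_ord RmultE mulr_sumr.
apply: eq_bigr => k _; rewrite /jcoef !pochE !RealsE /zvar.
by rewrite mulrA.
Qed.

(** Exactness in [is_JGL] quantifies over coefficients of powers of [y]; substituting [(1 - y) / 2]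
    keeps the degree, so it covers polynomials in [z] as well. *)
Lemma horner_zvar_as_sum (p : {poly R}) (m : nat) :
  (size p <= m.+1)%N ->
  exists c : nat -> R, forall y, sum_f_R0 (fun k => c k * y ^ k) m = p.[zvar y]%R.
Proof.
move=> pm; pose r : {poly R} := ((2^-1)%:P - (2^-1) *: 'X)%R.
have sr : (size r <= 2)%N.
  rewrite (leq_trans (size_polyD _ _)) // size_polyN geq_max.
  by rewrite (leq_trans (size_polyC_leq1 _)) // (leq_trans (size_scale_leq _ _)) // size_polyX.
have sq : (size (p \Po r)%R <= m.+1)%N.
  apply: leq_trans (size_comp_poly_leq _ _) _; rewrite ltnS.
  apply: leq_trans (leq_mul (_ : _ <= m)%N (_ : _ <= 1)%N) _; last by rewrite muln1.
    by rewrite -subn1 leq_subLR.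
  by rewrite -subn1 leq_subLR.
exists (fun k => (p \Po r)`_k)%R => y.
have -> : zvar y = r.[y]%R.
  by rewrite /zvar /r hornerD hornerN hornerZ hornerX hornerC !RealsE; ring.
rewrite -horner_comp (horner_coef_wide _ sq) sum_f_R0_ord.
by apply: eq_bigr => k _; rewrite !RealsE.
Qed.

Lemma jmean_integral (a b : R) (p : {poly R}) :
  -1 < a -> -1 < b ->
  is_RInt_gen (fun y => p.[zvar y]%R * (Rpower (1 - y) a * Rpower (1 + y) b))
    (at_right (-1)) (at_left 1) (jacobi_mass a b * jmean a b p).
Proof.
move=> a1 b1.
have H k : is_RInt_gen (fun y => (p`_k)%R *
      (((1 - y) / 2) ^ k * (Rpower (1 - y) a * Rpower (1 + y) b)))
    (at_right (-1)) (at_left 1)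
    ((p`_k)%R * (jacobi_mass a b * (poch (a + 1) k / poch (a + b + 2) k))).
  exact: (improper_scal _ _ _ _ _ (jacobi_weight_moment a b k a1 b1)).
(* A sum up to [size p] has one extra term, with coefficient zero; this spares the predecessor of
   the size, and the zero polynomial needs no separate case. *)
have := improper_sum (at_right (-1)) (at_left 1) (size p)
  (fun k y => (p`_k)%R * (((1 - y) / 2) ^ k * (Rpower (1 - y) a * Rpower (1 + y) b))) _
  (fun k _ => H k).
have -> : sum_f_R0 (fun k => (p`_k)%R * (jacobi_mass a b * (poch (a + 1) k / poch (a + b + 2) k)))
    (size p) = jacobi_mass a b * jmean a b p.
  rewrite sum_f_R0_ord (jmeanE _ _ (leqnSn (size p))) RmultE mulr_sumr.
  apply: eq_bigr => k _; rewrite /jmoment !pochE !RealsE; exact: mulrCA.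
move=> K; refine (improper_ext _ _ _ unit_ends _ _ _ _ (K _ _)).
move=> y _; rewrite sum_f_R0_ord (horner_coef_wide _ (leqnSn (size p))) [RHS]RmultE mulr_suml.
by apply: eq_bigr => k _; rewrite /zvar !RealsE mulrA.
Qed.

Lemma derivable_horner (p : {poly R}) (t : R) :
  derivable_pt_lim (fun u => p.[u]%R) t (p^`()).[t]%R.
Proof.
elim/poly_ind: p => [|p c IH].
  rewrite derivC horner0; apply: (derivable_pt_lim_ext (fun=> 0)) => [u|]; first by rewrite horner0.
  exact: derivable_pt_lim_const.
have -> : ((p * 'X + c%:P)^`()).[t]%R = ((p^`()).[t]%R * t + p.[t]%R * 1) + 0.
  by rewrite derivD derivM derivX derivC addr0 !hornerE !RealsE; ring.
apply: (derivable_pt_lim_ext (fun u => p.[u]%R * u + c)) => [u|].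
  by rewrite hornerD hornerMX hornerC.
apply: derivable_pt_lim_plus; last exact: derivable_pt_lim_const.
exact: (derivable_pt_lim_mult (fun u => p.[u]%R) id t _ 1 IH (derivable_pt_lim_id t)).
Qed.

Lemma derivable_zvar (y : R) : derivable_pt_lim zvar y (- (1 / 2)).
Proof. by apply/is_derive_Reals; rewrite /zvar; auto_derive => //; rewrite !RealsE; ring. Qed.

Lemma derivable_Jacobi (a b y : R) (n : nat) : -1 < a ->
  derivable_pt_lim (Jacobi a b n) y (((jac a b n)^`()).[zvar y]%R * - (1 / 2)).
Proof.
move=> a1; apply: (derivable_pt_lim_ext (fun u => (jac a b n).[zvar u]%R)) => [u|].
  by rewrite JacobiE.
exact: (derivable_pt_lim_comp zvar (fun u => (jac a b n).[u]%R) y _ _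
  (derivable_zvar y) (derivable_horner _ _)).
Qed.

(** * Nodes and exactness of the Gauss-Lobatto rule *)

Section Nodes.
Variables (a b : R) (N : nat) (x w : nat -> R).
Hypotheses (N1 : (0 < N)%N) (a1 : -1 < a) (b1 : -1 < b) (JGL : is_JGL a b N x w).

Lemma JGL_nodes (j : nat) : (j <= N)%N ->
  ('X * (1 - 'X) * (jac a b N)^`()).[zvar (x j)]%R = 0.
Proof.
move=> /ssrnat.leP jN; have [_ [/(_ (x j)) [H _] _]] := JGL.
have [d [Hd E]] := H (ex_intro _ j (conj jN erefl)).
move: E; rewrite (uniqueness_limite _ _ _ _ Hd (derivable_Jacobi a b (x j) N a1)).
rewrite hornerM hornerM hornerD hornerN hornerX hornerC; set D := horner _ _.
rewrite /zvar !RealsE => E.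
have -> : ((1 - x j) / 2 * (1 - (1 - x j) / 2) * D)%R
  = (- (1 / 2) * ((1 - x j ^+ 2) * (D * - (1 / 2))))%R by field.
by rewrite E mulr0.
Qed.

(** This makes every node a limit point of the domain [y > -1], on which the uniqueness of the limit
    in [Ihat_mat] depends. *)
Lemma JGL_nodes_ge (j : nat) : (j <= N)%N -> -1 <= x j.
Proof.
move=> /JGL_nodes /eqP; rewrite hornerM mulf_eq0 => H.
apply: Rnot_lt_le => xj.
have /RltP z1 : 1 < zvar (x j) by rewrite /zvar; Lra.lra.
move: H; rewrite (negbTE (deriv_jac_horner_neq0 (ltrN1 _ a1) (ltrN1 _ b1) N1 (ltW z1))) orbF.
rewrite hornerM hornerD hornerN hornerX hornerC mulf_eq0 subr_eq0.
by move: z1; rewrite R1E => z1 /orP[] /eqP; lra.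
Qed.

Lemma JGL_quad_exact (p : {poly R}) : (size p <= 2 * N)%N ->
  quad N (fun j => zvar (x j)) w p = (jacobi_mass a b * jmean a b p)%R.
Proof.
move=> sp; have [_ [_ Q]] := JGL.
have E : (2 * N - 1).+1 = (2 * N)%N by rewrite subn1 prednK // muln_gt0.
rewrite -E in sp; have [c Hc] := horner_zvar_as_sum p _ sp.
have /improper_intP Qc := Q c.
have -> : quad N (fun j => zvar (x j)) w p =
    sum_f_R0 (fun j => sum_f_R0 (fun k => c k * x j ^ k) (2 * N - 1) * w j) N.
  by rewrite sum_f_R0_ord; apply: eq_bigr => j _; rewrite Hc.
refine (improper_unique (at_right (-1)) (at_left 1) _ _ _ Qc _).
refine (improper_ext _ _ _ unit_ends _ _ _ _ (jmean_integral a b p a1 b1)).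
by move=> y _; rewrite Hc Rmult_assoc.
Qed.

Lemma JGL_nodes_inj (i j : nat) : (i <= N)%N -> (j <= N)%N -> x i = x j -> i = j.
Proof.
have [inc _] := JGL.
have mono k m : (k < m <= N)%N -> x k < x m.
  elim: m => // m IH /andP[km mN].
  have xm : x m < x m.+1 by apply: inc; apply/ssrnat.ltP.
  move: km; rewrite ltnS leq_eqVlt => /orP[/eqP-> //|km].
  by apply: Rlt_trans xm; apply: IH; rewrite km ltnW.
move=> iN jN E; case: (ltngtP i j) => // H; exfalso.
- by have := mono i j; rewrite H jN E => /(_ isT) /Rlt_irrefl.
- by have := mono j i; rewrite H iN E => /(_ isT) /Rlt_irrefl.
Qed.

End Nodes.

(** Both sides obey the same recursion, lowering [n] and raising both parameters; the 4 in
    [jacobi_mass_shift] cancels the one in [gamma_n_S]. *)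
Lemma gamma_nE (a b : R) (n : nat) :
  -1 < a -> -1 < b -> gamma_n a b n = (jacobi_mass a b * jnorm a b n)%R.
Proof.
elim: n a b => [|n IH] a b a1 b1; first by rewrite jnorm0 mulr1.
have [a2 b2] : -1 < a + 1 /\ -1 < b + 1 by split; Lra.lra.
rewrite gamma_n_S // IH // jacobi_mass_shift // jnormS ?ltrN1 // /shift_ratio.
have n0 := natr_neq0 R n; rewrite !RealsE /=.
have h1 : (a + b + 2 != 0)%R by move: (ltrN1 _ a1) (ltrN1 _ b1); lra.
have h2 : (a + b + 3 != 0)%R by move: (ltrN1 _ a1) (ltrN1 _ b1); lra.
by field; rewrite h1 h2 addrC natr1.
Qed.

Lemma gamma_tildeE (a b : R) (N n : nat) :
  -1 < a -> -1 < b -> gamma_tilde a b N n = (jacobi_mass a b * jnormt a b N n)%R.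
Proof.
move=> a1 b1; rewrite /gamma_tilde /jnormt gamma_nE //.
have -> : Nat.eqb n N = (n == N) by apply/PeanoNat.Nat.eqb_spec/eqP.
by case: eqP => // _; rewrite !RealsE mulrCA.
Qed.

Lemma lagrange_node (x : nat -> R) (N i j : nat) :
  (forall i j, (i <= N)%N -> (j <= N)%N -> x i = x j -> i = j) ->
  (i <= N)%N -> (j <= N)%N -> Defs.lagrange x N j (x i) = ((i == j)%:R)%R.
Proof.
move=> inj iN jN; rewrite /Defs.lagrange prodR_ord; case: eqVneq => [->|ij].
  apply: big1 => k _; case: PeanoNat.Nat.eqb_spec => // kj.
  rewrite !RealsE divff // subr_eq0; apply/eqP => /inj E.
  by apply: kj; rewrite E // -ltnS.
rewrite (bigD1 (Ordinal (iN : (i < N.+1)%N))) //=.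
case: PeanoNat.Nat.eqb_spec => [E|_]; first by rewrite E eqxx in ij.
by rewrite !RealsE subrr !mul0r.
Qed.

Lemma lagrange_poly (x : nat -> R) (N j : nat) : (j <= N)%N ->
  exists2 p : {poly R}, (size p <= N.+1)%N & forall y, Defs.lagrange x N j y = p.[zvar y]%R.
Proof.
move=> jN; pose jo := Ordinal (jN : (j < N.+1)%N).
(* This is [(y - x k) / (x j - x k)] with [y = 1 - 2 z]. *)
pose f (k : 'I_N.+1) : {poly R} := (((1 - x k) / (x j - x k))%:P - (2 / (x j - x k)) *: 'X)%R.
exists (\prod_(k < N.+1 | k != jo) f k)%R.
  apply: leq_trans (size_prod_leq _ _) _.
  have cN : #|(fun k : 'I_N.+1 => k != jo)| = N.
    by apply: etrans (eq_card (_ : _ =i predC1 jo)) _ => //; rewrite cardC1 card_ord.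
  rewrite cN.
  rewrite leq_subLR addnS ltnS addnn -mul2n.
  have s2 k : (size (f k) <= 2)%N.
    rewrite (leq_trans (size_polyD _ _)) // size_polyN geq_max.
    by rewrite (leq_trans (size_polyC_leq1 _)) // (leq_trans (size_scale_leq _ _)) // size_polyX.
  apply: leq_trans (leq_sum _ (fun k _ => s2 k)) _.
  by rewrite sum_nat_const cN mulnC.
move=> y; rewrite /Defs.lagrange prodR_ord (bigD1 jo) //= PeanoNat.Nat.eqb_refl mul1r.
rewrite horner_prod; apply: eq_bigr => k kj.
case: PeanoNat.Nat.eqb_spec => [E|_]; first by case/eqP: kj; apply: val_inj.
rewrite /f hornerD hornerN hornerZ hornerX hornerC /zvar !RealsE /=.
by move: (_^-1)%R => e; field.
Qed.

Lemma lagrange_expansion (a b : R) (N : nat) (x w : nat -> R) (j : nat) (y : R) :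
  (1 <= N)%coq_nat -> -1 < a -> -1 < b -> is_JGL a b N x w -> (j <= N)%coq_nat ->
  Defs.lagrange x N j y = sum_f_R0 (fun n => t_coef a b N x w n j * Jacobi a b n y) N.
Proof.
move=> /ssrnat.leP N1 a1 b1 JGL /ssrnat.leP jN.
have [p sp Hp] := lagrange_poly x N j jN.
have M0 : (jacobi_mass a b != 0)%R.
  by rewrite gt_eqF //; apply/RltP; exact: jacobi_mass_pos.
rewrite Hp (quad_expansion (ltrN1 _ a1) (ltrN1 _ b1) N1 M0
  (JGL_quad_exact a b N x w N1 a1 b1 JGL) (JGL_nodes a b N x w a1 JGL) sp).
rewrite horner_sum sum_f_R0_ord; apply: eq_bigr => n _.
rewrite hornerZ /t_coef !JacobiE // gamma_tildeE //.
rewrite (quad_delta _ _ jN) // => [|i iN].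
  by rewrite !RealsE; ring.
by rewrite -Hp lagrange_node // => i' j'; apply: (JGL_nodes_inj a b N x w JGL).
Qed.

(** * Connection coefficients and the Legendre expansion *)

Lemma conn_spec (a b c d : R) (n : nat) :
  -1 < a -> -1 < b -> -1 < c -> -1 < d -> forall y,
  Jacobi a b n y = sum_f_R0 (fun k => conn a b c d k n * Jacobi c d k y) n.
Proof.
move=> a1 b1 c1 d1; rewrite /conn.
set P := (fun C : nat -> R => _); apply: (epsilon_spec (inhabits (fun=> 0)) P).
have [|C HC] := @jac_expansion _ c d n.+1 (jac a b n) (ltrN1 _ c1) (ltrN1 _ d1).
  exact: size_poly.
exists C => y; rewrite JacobiE // HC horner_sum sum_f_R0_ord.
by apply: eq_bigr => k _; rewrite hornerZ JacobiE.
Qed.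

Lemma horner_zvar_inj (p q : {poly R}) : (forall y, p.[zvar y] = q.[zvar y])%R -> p = q.
Proof.
move=> H; apply/eqP; rewrite -subr_eq0; apply/eqP.
apply: (@roots_geq_poly_eq0 _ _ [seq i%:R%R | i <- iota 0 (size (p - q)%R)]).
- apply/allP => r _; apply/eqP; rewrite hornerD hornerN.
  have -> : r = zvar (1 - 2 * r) by rewrite /zvar !RealsE /=; field.
  by rewrite H subrr.
- by rewrite map_inj_uniq ?iota_uniq // => i k /eqP; rewrite eqr_nat => /eqP.
- by rewrite size_map size_iota.
Qed.

(** The choice made by [conn] constrains only the coefficients with [l <= n]; for those,
    independence of the Jacobi polynomials leaves a single possibility. *)
Lemma conn_diag (a b : R) (l n : nat) :
  -1 < a -> -1 < b -> (l <= n)%coq_nat ->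
  conn a b a b l n = if Nat.eqb l n then 1 else 0.
Proof.
move=> a1 b1 /ssrnat.leP ln.
have -> : Nat.eqb l n = (l == n) by apply/PeanoNat.Nat.eqb_spec/eqP.
have E : (\sum_(k < n.+1) conn a b a b k n *: jac a b k
          = \sum_(k < n.+1) (k == n :> nat)%:R *: jac a b k)%R.
  transitivity (jac a b n).
    apply: horner_zvar_inj => y; rewrite -JacobiE // (conn_spec a b a b n a1 b1 a1 b1).
    rewrite sum_f_R0_ord horner_sum; apply: eq_bigr => k _.
    by rewrite hornerZ JacobiE.
  rewrite big_ord_recr /= eqxx scale1r big1 ?add0r // => k _.
  by rewrite ltn_eqF ?scale0r.
have := @jac_independent _ a b n.+1 (fun k => conn a b a b k n) (fun k => (k == n)%:R)%R
  (ltrN1 _ a1) (ltrN1 _ b1) E l ln.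
by case: eqP.
Qed.

Lemma lagrange_expansion_conn (a b c d : R) (N : nat) (x w : nat -> R) (j : nat) (y : R) :
  (1 <= N)%coq_nat -> -1 < a -> -1 < b -> -1 < c -> -1 < d ->
  is_JGL a b N x w -> (j <= N)%coq_nat ->
  Defs.lagrange x N j y =
  sum_f_R0 (fun l => sum_f l N (fun n => conn a b c d l n * t_coef a b N x w n j)
                     * Jacobi c d l y) N.
Proof.
move=> N1 a1 b1 c1 d1 JGL jN; rewrite (lagrange_expansion a b N x w) // !sum_f_R0_ord.
pose u n l : R := (conn a b c d l n * t_coef a b N x w n j * Jacobi c d l y)%R.
(* The double sum is over the triangle [l <= n <= N]. In the other order the inner sum starts at
   [n = l], which [sum_f l N] expresses by an index shifted by [l]. *)
transitivity (\sum_(n < N.+1) \sum_(l < N.+1 | (l <= n)%N) u n l)%R.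
  apply: eq_bigr => n _; rewrite (conn_spec a b c d) // sum_f_R0_ord RmultE mulr_sumr.
  rewrite (big_ord_widen N.+1
    (fun l => t_coef a b N x w n j * (conn a b c d l n * Jacobi c d l y))%R (ltn_ord n)).
  by apply: eq_bigr => l _; rewrite /u mulrA [(t_coef _ _ _ _ _ _ _ * _)%R]mulrC.
rewrite (exchange_big_dep xpredT) //=; apply: eq_bigr => l _.
rewrite /sum_f sum_f_R0_ord RmultE mulr_suml.
have lN : (l <= N)%N by rewrite -ltnS.
transitivity (\sum_(l <= n < N.+1) u n l)%R.
  by rewrite (big_nat_widenl l 0) // big_mkord.
by rewrite -{1}[nat_of_ord l]add0n big_addn big_mkord subSn.
Qed.

(** The parameters [(0, 0)] and [(mu, -mu)] have the same sum, hence the same symbols [(-l)_k] and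
    [(l + 1)_k] in the numerator. Integrating [(1 + t)^k] multiplies by [k! / Gamma(k + mu + 1)],
    which turns one [(1)_k] of the denominator into [(mu + 1)_k] and so one hypergeometric series
    into the other. *)
Lemma frac_integral_legendre (mu y : R) (l : nat) :
  0 < mu < 1 -> -1 < y ->
  is_RInt_gen (fun t => Rpower (y - t) (mu - 1) * Jacobi 0 0 l t) (at_right (-1)) (at_left y)
    (Gamma mu * Rpower (1 + y) mu *
     (INR (fact l) / Gamma (INR l + mu + 1) * Jacobi (- mu) mu l y)).
Proof.
move=> mu01 y1.
have [m0 [m1 m2]] : 0 < mu + 1 /\ -1 < - mu /\ -1 < mu by repeat split; Lra.lra.
have z1 : -1 < 0 by Lra.lra.
have mu0 : 0 < mu by case: mu01.
have G0 : (Gamma (mu + 1) != 0)%R by rewrite gt_eqF //; apply/RltP; exact: Gamma_pos.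
have GE k : Gamma (INR k + mu + 1) = (pochr (mu + 1) k * Gamma (mu + 1))%R.
  rewrite -pochE -RmultE -Gamma_poch //; congr Gamma; rewrite !RealsE; ring.
have pn0 k : (pochr (mu + 1) k != 0)%R by rewrite -pochE gt_eqF //; apply/RltP; exact: poch_pos.
have poch1 k : (pochr (0 + 1) k = k`!%:R :> R)%R.
  elim: k => [|k IH]; first by rewrite pochr0.
  by rewrite pochrS IH factS natrM -natr1; ring.
(* The coefficients of the Legendre polynomial in powers of [1 + t], with the sign of the
   reflection. *)
pose c k : R := ((-1) ^+ l * jcoef 0 0 l k / 2 ^+ k)%R.
have H k := improper_scal _ _ _ (c k) _ (frac_integral_monomial mu y k mu0 y1).
have K := improper_sum (at_right (-1)) (at_left y) l _ _ (fun k _ => H _ _ k).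
have refl (p q t : R) : -1 < p -> -1 < q ->
    (jac p q l).[zvar t]%R = ((-1) ^+ l * (jac q p l).[(1 + t) / 2])%R.
  move=> p1 q1; have -> : ((1 + t) / 2 = 1 - zvar t)%R by rewrite /zvar !RealsE /=; field.
  by rewrite (horner_jac_refl _ _ (ltrN1 _ p1) (ltrN1 _ q1)) mulrA -expr2 sqrr_sign mul1r.
have -> : Gamma mu * Rpower (1 + y) mu *
     (INR (fact l) / Gamma (INR l + mu + 1) * Jacobi (- mu) mu l y) =
  sum_f_R0 (fun k => c k * (Gamma mu * INR (fact k) / Gamma (INR k + mu + 1)
                            * Rpower (1 + y) mu * (1 + y) ^ k)) l.
  rewrite JacobiE // refl // horner_poly sum_f_R0_ord !RmultE !mulr_sumr.
  apply: eq_bigr => k _; rewrite !GE /c /jcoef !RealsE /= expr_div_n !poch1.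
  have -> : (l%:R + mu - mu + 1 = l%:R + 0 + 0 + 1 :> R)%R by ring.
  have p2 : (2%:R ^+ k != 0 :> R)%R by apply: expf_neq0; rewrite pnatr_eq0.
  by field; rewrite !fact_neq0 !pn0 p2 !andbT; exact: G0.
refine (improper_ext _ _ _ (bounded_interval_ends (-1) y y1) _ _ _ _ (K _ _ _ _)).
move=> t _; rewrite JacobiE // refl // horner_poly sum_f_R0_ord [RHS]RmultE !mulr_sumr.
apply: eq_bigr => k _; rewrite /c !RealsE expr_div_n; ring.
Qed.

Lemma continuity_pt_Jacobi (a b y : R) (n : nat) : -1 < a -> continuity_pt (Jacobi a b n) y.
Proof.
move=> a1; apply: derivable_continuous_pt; exists (((jac a b n)^`()).[zvar y]%R * - (1 / 2)).
exact: derivable_Jacobi.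
Qed.

End RealJacobi.
Import RealJacobi.

(** * The fractional integration matrix *)

Lemma Ihat_legendre_sum (mu y : R) (h : R -> R) (s : nat -> R) (N : nat) :
  0 < mu < 1 -> -1 < y ->
  (forall t, h t = sum_f_R0 (fun l => s l * Jacobi 0 0 l t) N) ->
  Ihat mu h y =
  sum_f_R0 (fun l => INR (fact l) / Gamma (INR l + mu + 1) * s l * Jacobi (- mu) mu l y) N.
Proof.
intros mu01 y1 Hh; assert (mu0 : 0 < mu) by lra.
pose proof (Gamma_pos mu mu0) as G0.
set (T := fun l => INR (fact l) / Gamma (INR l + mu + 1) * s l * Jacobi (- mu) mu l y).
assert (I : is_RInt_gen (fun t => Rpower (y - t) (mu - 1) * h t) (at_right (-1)) (at_left y)
              (sum_f_R0 (fun l => T l * (Gamma mu * Rpower (1 + y) mu)) N)).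
{ pose proof (improper_sum (at_right (-1)) (at_left y) N _ _
    (fun l _ => improper_scal _ _ _ (s l) _ (frac_integral_legendre mu y l mu01 y1))) as K.
  rewrite (sum_eq (fun l => T l * (Gamma mu * Rpower (1 + y) mu)) (fun l => s l *
     (Gamma mu * Rpower (1 + y) mu *
     (INR (fact l) / Gamma (INR l + mu + 1) * Jacobi (- mu) mu l y)))).
  2:{ intros l _; unfold T; ring. }
  refine (improper_ext _ _ _ (bounded_interval_ends (-1) y y1) _ _ _ _ K).
  intros t _; simpl; rewrite Hh, scal_sum; apply sum_eq; intros l _; ring. }
rewrite <- scal_sum in I.
unfold Ihat, Ifrac.
set (P := fun L => improper_int _ _ _ _).
assert (HP : P (epsilon (inhabits 0) P)).
{ apply epsilon_spec; eexists; apply improper_intP; exact I. }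
rewrite (improper_unique (at_right (-1)) (at_left y) _ _ _ (proj1 (improper_intP _ _ _ _) HP) I).
rewrite Rpower_Ropp; pose proof (Rpower_pos (1 + y) mu); field; lra.
Qed.

Lemma continuity_pt_sum (f : nat -> R -> R) (N : nat) (y : R) :
  (forall k, continuity_pt (f k) y) ->
  continuity_pt (fun t => sum_f_R0 (fun k => f k t) N) y.
Proof.
intros H; induction N as [|N IH]; simpl; [apply H|].
apply (continuity_pt_plus (fun t => sum_f_R0 (fun k => f k t) N) (f (S N))); auto.
Qed.

Lemma limit1_in_continuous_ext (f g : R -> R) (D : R -> Prop) (y : R) :
  (forall t, D t -> f t = g t) -> continuity_pt g y -> limit1_in f D (g y) y.
Proof.
intros E C eps e0; destruct (C eps e0) as [d [d0 Hd]]; exists d; split; auto.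
intros t [Dt td]; rewrite (E t Dt).
(* [limit1_in] allows [t = y] when [y] is in [D], whereas continuity only speaks of other points. *)
destruct (Req_dec y t) as [->|ne].
- simpl; rewrite Rdist_eq; auto.
- apply Hd; repeat split; auto.
Qed.

Lemma sum_f_R0_head (f : nat -> R) (n : nat) :
  (forall k, (1 <= k <= n)%nat -> f k = 0) -> sum_f_R0 f n = f 0%nat.
Proof.
induction n as [|n IH]; intros H; simpl; auto.
rewrite IH, (H (S n)) by (try lia; intros; apply H; lia); ring.
Qed.

Theorem theorem3p4 (N : nat) (a b mu : R) (x w : nat -> R) :
  (1 <= N)%nat -> -1 < a -> -1 < b -> is_JGL a b N x w -> 0 < mu < 1 ->
  (forall i j, (i <= N)%nat -> (j <= N)%nat ->
     Ihat_mat mu x N i j =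
     sum_f_R0 (fun l => INR (fact l) / Gamma (INR l + mu + 1)
                        * s_hat a b N x w l j * Jacobi (- mu) mu l (x i)) N) /\
  (a = 0 -> b = 0 -> forall l j, (l <= N)%nat -> (j <= N)%nat ->
     s_hat a b N x w l j = t_coef a b N x w l j).
Proof.
intros N1 a1 b1 JGL mu01; split.
- intros i j iN jN; assert (z1 : -1 < 0) by lra.
  pose proof (fun y => Ihat_legendre_sum mu y (lagrange x N j)
    (fun l => s_hat a b N x w l j) N mu01) as H.
  set (g := fun y => sum_f_R0 (fun l => INR (fact l) / Gamma (INR l + mu + 1)
                        * s_hat a b N x w l j * Jacobi (- mu) mu l y) N).
  (* The formula is available only for [y > -1]; the polynomial [g] is continuous at every node and
     so also supplies the value at [x_0 = -1]. *)
  assert (L : limit1_in (Ihat mu (lagrange x N j)) (fun y => -1 < y) (g (x i)) (x i)).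
  { apply limit1_in_continuous_ext.
    - intros y y1; apply H; auto; intros t.
      now apply lagrange_expansion_conn.
    - apply continuity_pt_sum; intros l.
      apply (continuity_pt_mult (fun _ => _)); [apply continuity_pt_const; now intros ? ?|].
      apply continuity_pt_Jacobi; lra. }
  assert (L' : limit1_in (Ihat mu (lagrange x N j)) (fun y => -1 < y)
                 (Ihat_mat mu x N i j) (x i)).
  { unfold Ihat_mat; set (P := fun l => limit1_in _ _ l _).
    apply (epsilon_spec (inhabits 0) P); now exists (g (x i)). }
  refine (single_limit _ _ _ _ _ _ L' L).
  assert (xi : -1 <= x i).
  { apply (JGL_nodes_ge a b N x w); auto; now apply (ssrbool.introT ssrnat.leP). }
  (* Approaching from the right stays inside [y > -1] even when [x i = -1]. *)
  intros e e0; exists (x i + e / 2); split; [lra|].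
  unfold Rdist; rewrite Rabs_pos_eq; lra.
- intros -> -> l j lN jN; unfold s_hat, sum_f.
  (* The sum starts at [n = l], so its head is the diagonal coefficient 1, and all later ones
     vanish. *)
  rewrite sum_f_R0_head; simpl.
  + rewrite conn_diag, Nat.eqb_refl by (lra || lia); ring.
  + intros k Hk; rewrite conn_diag by (lra || lia).
    destruct (Nat.eqb_spec l (k + l)); [lia|ring].
Qed.
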